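(* Let $Y$, $x$, $T$ be as in the context. Let $W,W'$ be irreducible $T$-modules with endpoints $r,r'$, dual endpoints $t,t'$ and diameters $d,d'$ respectively. The following are equivalent: (i) $W$ and $W'$ are isomorphic as $T$-modules; (ii) $t=t'$ and $d=d'$; (iii) $t=t'$ and $r=r'$; (iv) $B(W)=B(W')$; (v) $t=t'$ and $B^*(W)=B^*(W')$.
   Context: $Y=(X,\{R_i\}_{0\le i\le D})$ is a symmetric association scheme ($X$ finite; $R_i$ partition $X\times X$, $R_0$ diagonal, $R_i$ symmetric; $p^h_{ij}=|\{z:(x,z)\in R_i,(z,y)\in R_j\}|$ for $(x,y)\in R_h$ independent of $x,y$), with $D\ge3$, associate matrices $A_i$, Bose–Mesner algebra $M=\mathrm{span}\{A_i\}$ with primitive idempotents $E_0,\dots,E_D$, Krein parameters $q^h_{ij}$ ($E_i\circ E_j=|X|^{-1}\sum_hq^h_{ij}E_h$). $Y$ is P-polynomial w.r.t. $R_0,\dots,R_D$ ($p^h_{ij}=0$ if one of $h,i,j$ exceeds the sum of the other two, $\ne0$ if it equals that sum), almost-bipartite ($p^i_{1i}=0$ for $0\le i\le D-1$, $p^D_{1D}\ne0$), and Q-polynomial w.r.t. $E_0,\dots,E_D$ (same conditions for $q^h_{ij}$). $A=A_1$. Fix $x\in X$: $E^*_i$ diagonal with $(E^*_i)_{yy}=1$ iff $(x,y)\in R_i$; $A^*$ diagonal with $(A^* )_{yy}=|X|(E_1)_{xy}$. $E_i=E^*_i=0$ for $i\notin[0,D]$. $T=T(x)$ is generated by $M$ and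 $\mathrm{span}\{E^*_i\}$. $R=\sum_iE^*_{i+1}AE^*_i$, $F=\sum_iE^*_iAE^*_i$, $L=\sum_iE^*_{i-1}AE^*_i$, $R^*=\sum_iE_{i+1}A^*E_i$, $F^*=\sum_iE_iA^*E_i$, $L^*=\sum_iE_{i-1}A^*E_i$. A $T$-module isomorphism $W\to W'$ is a linear isomorphism $\phi$ with $B\phi=\phi B$ on $W$ for all $B\in T$. For an irreducible $T$-module $W$: endpoint $r=\min\{i:E^*_iW\neq0\}$, dual endpoint $t=\min\{i:E_iW\ne0\}$, diameter $d=|\{i:E^*_iW\ne0\}|-1$. In this setting every irreducible $W$ is thin and dual thin. The intersection numbers $c_i(W),a_i(W),b_i(W)$ are the scalars with $RE^*_{r+i-1}v=c_i(W)E^*_{r+i}v$, $FE^*_{r+i}v=a_i(W)E^*_{r+i}v$, $LE^*_{r+i+1}v=b_i(W)E^*_{r+i}v$ ($0\le i\le d$) for nonzero $v\in E_tW$; the dual intersection numbers $c^*_i(W),a^*_i(W),b^*_i(W)$ are defined likewise by $R^*E_{t+i-1}v=c^*_i(W)E_{t+i}v$, $F^*E_{t+i}v=a^*_i(W)E_{t+i}v$, $L^*E_{t+i+1}v=b^*_i(W)E_{t+i}v$ for nonzero $v\in E^*_rW$. $B(W)$ is the $(d+1)\times(d+1)$ tridiagonal matrix with diagonal $a_0(W),\dots,a_d(W)$, superdiagonal $b_0(W),\dots,b_{d-1}(W)$ and subdiagonal $c_1(W),\dots,c_d(W)$; $B^*(W)$ is defined the same way from the dual intersection numbers. *)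

(* Defs.v *)
From HB Require Import structures.
From mathcomp Require Import all_boot all_order all_algebra.
From mathcomp Require Import boolp classical_sets.

Set Implicit Arguments.
Unset Strict Implicit.
Unset Printing Implicit Defensive.

Import Order.TTheory GRing.Theory Num.Theory.
Local Open Scope ring_scope.

(** ** Symmetric association schemes *)

(* [pnum h i j] is the intersection number p^h_{ij}.  It is a field of the
   record, but it is determined by [srel] since every [srel h] is nonempty. *)
Record assoc_scheme (X : finType) (D : nat) := AssocScheme {
  srel : 'I_D.+1 -> rel X;
  pnum : 'I_D.+1 -> 'I_D.+1 -> 'I_D.+1 -> nat;
  srel_partition : forall y z, exists! i, srel i y z;
  srel_nonempty : forall i, exists y z, srel i y z;
  srel0 : forall y z, srel ord0 y z = (y == z);
  srel_sym : forall i, symmetric (srel i);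
  pnumP : forall h i j y z, srel h y z ->
    #|[set w | srel i y w && srel j w z]| = pnum h i j
}.

(* The condition shared by the P-polynomial property (f = p) and the
   Q-polynomial property (f = q); [f h i j] stands for f^h_{ij}. *)
Definition triangular (D : nat) (S : nmodType)
    (f : 'I_D.+1 -> 'I_D.+1 -> 'I_D.+1 -> S) : Prop :=
  forall h i j : 'I_D.+1,
    ([|| i + j < h, h + j < i | h + i < j]%N -> f h i j = 0) /\
    ([|| h == i + j :> nat, i == h + j :> nat | j == h + i :> nat]%N ->
       f h i j <> 0).

Definition P_polynomial X D (Y : assoc_scheme X D) : Prop :=
  triangular (pnum Y).

Definition almost_bipartite X D (Y : assoc_scheme X D) : Prop :=
  (forall i : 'I_D.+1, (i < D)%N -> pnum Y i (inord 1) i = 0%N) /\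
  pnum Y ord_max (inord 1) ord_max <> 0%N.

(** ** Bose-Mesner algebra *)

(* Matrices with rows and columns indexed by X are represented in 'M_#|X|,
   via the enumeration of X. *)
Definition assoc_mx (C : fieldType) X D (Y : assoc_scheme X D) (i : 'I_D.+1) :
    'M[C]_#|X| :=
  \matrix_(y, z) (srel Y i (enum_val y) (enum_val z))%:R.

Definition bose_mesner (C : fieldType) X D (Y : assoc_scheme X D) :
    {vspace 'M[C]_#|X|} :=
  <<[tuple assoc_mx C Y i | i < D.+1]>>%VS.

(* As usual, the trivial idempotent |X|^-1 J is numbered E_0. *)
Record primitive_idempotents (C : fieldType) X D (Y : assoc_scheme X D)
    (E : 'I_D.+1 -> 'M[C]_#|X|) : Prop := PrimitiveIdempotents {
  pidem_basis : basis_of (bose_mesner C Y) [tuple E i | i < D.+1];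
  pidem_mul : forall i j, E i *m E j = if i == j then E i else 0;
  pidem_sum : \sum_i E i = 1%:M;
  pidem0 : E ord0 = const_mx (#|X|%:R^-1)
}.

(* [krein E h i j] is the Krein parameter q^h_{ij}: |X| times the coordinate on
   E_h of the entrywise product of E_i and E_j. *)
Definition krein (C : fieldType) (X : finType) (D : nat)
    (E : 'I_D.+1 -> 'M[C]_#|X|) (h i j : 'I_D.+1) : C :=
  #|X|%:R * coord [tuple E k | k < D.+1] h (map2_mx *%R (E i) (E j)).

Definition Q_polynomial (C : fieldType) (X : finType) (D : nat)
    (E : 'I_D.+1 -> 'M[C]_#|X|) : Prop :=
  triangular (krein E).

(** ** Terwilliger algebra *)

Definition dual_idem (C : fieldType) X D (Y : assoc_scheme X D) (x : X)
    (i : 'I_D.+1) : 'M[C]_#|X| :=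
  diag_mx (\row_y (srel Y i x (enum_val y))%:R).

Definition dual_adj (C : fieldType) (X : finType) (D : nat)
    (E : 'I_D.+1 -> 'M[C]_#|X|) (x : X) : 'M[C]_#|X| :=
  diag_mx (\row_y (#|X|%:R * E (inord 1) (enum_rank x) y)).

Definition dual_bose_mesner (C : fieldType) X D (Y : assoc_scheme X D) (x : X) :
    {vspace 'M[C]_#|X|} :=
  <<[tuple dual_idem C Y x i | i < D.+1]>>%VS.

Inductive terwilliger (C : fieldType) X D (Y : assoc_scheme X D) (x : X) :
    'M[C]_#|X| -> Prop :=
| Terw_bm B : B \in bose_mesner C Y -> terwilliger Y x B
| Terw_dbm B : B \in dual_bose_mesner C Y x -> terwilliger Y x B
| Terw_add B1 B2 :
    terwilliger Y x B1 -> terwilliger Y x B2 -> terwilliger Y x (B1 + B2)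
| Terw_scale a B : terwilliger Y x B -> terwilliger Y x (a *: B)
| Terw_mul B1 B2 :
    terwilliger Y x B1 -> terwilliger Y x B2 -> terwilliger Y x (B1 *m B2).

(* A family indexed by 0..D, extended by 0 to all integer indices. *)
Definition ext0 (D : nat) (V : nmodType) (F : 'I_D.+1 -> V) (k : int) : V :=
  if k is Posz n then oapp F 0 (insub n) else 0.

(* With F = E^* and B = A these are R, F, L; with F = E and B = A^* they are
   R^*, F^*, L^*. *)
Definition raising (C : fieldType) (n D : nat) (F : 'I_D.+1 -> 'M[C]_n)
    (B : 'M[C]_n) : 'M[C]_n :=
  \sum_(i < D.+1) ext0 F (i%:Z + 1) *m B *m F i.

Definition flat (C : fieldType) (n D : nat) (F : 'I_D.+1 -> 'M[C]_n)
    (B : 'M[C]_n) : 'M[C]_n :=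
  \sum_(i < D.+1) F i *m B *m F i.

Definition lowering (C : fieldType) (n D : nat) (F : 'I_D.+1 -> 'M[C]_n)
    (B : 'M[C]_n) : 'M[C]_n :=
  \sum_(i < D.+1) ext0 F (i%:Z - 1) *m B *m F i.

(** ** Modules *)

(* T-modules are the T-invariant subspaces of the standard module 'cV_#|X|. *)
Definition mximg (C : fieldType) (n : nat) (B : 'M[C]_n)
    (W : {vspace 'cV[C]_n}) : {vspace 'cV[C]_n} :=
  (linfun (mulmx B : 'cV[C]_n -> 'cV[C]_n) @: W)%VS.

Definition T_module (C : fieldType) X D (Y : assoc_scheme X D) (x : X)
    (W : {vspace 'cV[C]_#|X|}) : Prop :=
  forall B, terwilliger Y x B -> (mximg B W <= W)%VS.

Definition irreducible_T_module (C : fieldType) X D (Y : assoc_scheme X D)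
    (x : X) (W : {vspace 'cV[C]_#|X|}) : Prop :=
  [/\ T_module Y x W, W <> 0%VS &
      forall U : {vspace 'cV[C]_#|X|}, T_module Y x U -> (U <= W)%VS ->
        U = 0%VS \/ U = W].

(* The isomorphism W -> W' is the restriction to W of an endomorphism phi of
   the standard module. *)
Definition T_isomorphic (C : fieldType) X D (Y : assoc_scheme X D) (x : X)
    (W W' : {vspace 'cV[C]_#|X|}) : Prop :=
  exists phi : 'End('cV[C]_#|X|),
    [/\ {in W &, injective phi}, (phi @: W)%VS = W' &
        forall B, terwilliger Y x B ->
          {in W, forall w, phi (B *m w) = B *m phi w}].

(* Least i <= D with F_i W <> 0: the endpoint for F = E^*, the dual endpoint
   for F = E. *)
Definition first_index (C : fieldType) (n D : nat) (F : 'I_D.+1 -> 'M[C]_n)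
    (W : {vspace 'cV[C]_n}) : nat :=
  find (fun i : 'I_D.+1 => mximg (F i) W != 0%VS) (enum 'I_D.+1).

Definition endpoint (C : fieldType) X D (Y : assoc_scheme X D) (x : X)
    (W : {vspace 'cV[C]_#|X|}) : nat :=
  first_index (dual_idem C Y x) W.

Definition dual_endpoint (C : fieldType) (X : finType) (D : nat)
    (E : 'I_D.+1 -> 'M[C]_#|X|) (W : {vspace 'cV[C]_#|X|}) : nat :=
  first_index E W.

Definition diameter (C : fieldType) X D (Y : assoc_scheme X D) (x : X)
    (W : {vspace 'cV[C]_#|X|}) : nat :=
  #|[set i : 'I_D.+1 | mximg (dual_idem C Y x i) W != 0%VS]|.-1.

(** ** Intersection numbers of a module *)

(* The scalar a such that P v = a Q v for all nonzero v in U (0 if none). *)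
Definition scalar_on (C : fieldType) (n : nat) (U : {vspace 'cV[C]_n})
    (P Q : 'M[C]_n) : C :=
  xget 0 [set a : C | forall v : 'cV[C]_n,
    v \in U -> v != 0 -> P *m v = a *: (Q *m v)]%classic.

(* The numbers c_i, a_i, b_i attached to the family F, the matrix B, the
   starting index s and the space U of test vectors.  For F = E^*, B = A, s = r
   and U = E_t W these are c_i(W), a_i(W), b_i(W); for F = E, B = A^*, s = t and
   U = E^*_r W they are the dual intersection numbers. *)
Section ModuleNumbers.

Context (C : fieldType) (n D : nat) (F : 'I_D.+1 -> 'M[C]_n) (B : 'M[C]_n).
Context (s : nat) (U : {vspace 'cV[C]_n}).

Definition c_num (i : nat) : C :=
  scalar_on U (raising F B *m ext0 F (s%:Z + i%:Z - 1)) (ext0 F (s%:Z + i%:Z)).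

Definition a_num (i : nat) : C :=
  scalar_on U (flat F B *m ext0 F (s%:Z + i%:Z)) (ext0 F (s%:Z + i%:Z)).

Definition b_num (i : nat) : C :=
  scalar_on U (lowering F B *m ext0 F (s%:Z + i%:Z + 1)) (ext0 F (s%:Z + i%:Z)).

Definition tridiag_mx (d : nat) : 'M[C]_d.+1 :=
  \matrix_(i, j)
    if j == i then a_num i
    else if j == i.+1 :> nat then b_num i
    else if i == j.+1 :> nat then c_num i
    else 0.

End ModuleNumbers.

(* B(W) and B^*(W) are packaged with their size, so that matrices of modules of
   different diameters can be compared. *)
Definition inter_mx (C : fieldType) X D (Y : assoc_scheme X D)
    (E : 'I_D.+1 -> 'M[C]_#|X|) (x : X) (W : {vspace 'cV[C]_#|X|}) :
    {d : nat & 'M[C]_d.+1} :=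
  Tagged (fun d => 'M[C]_d.+1)
    (tridiag_mx (dual_idem C Y x) (assoc_mx C Y (inord 1))
       (endpoint Y x W)
       (mximg (ext0 E (dual_endpoint E W)%:Z) W)
       (diameter Y x W)).

Definition dual_inter_mx (C : fieldType) X D (Y : assoc_scheme X D)
    (E : 'I_D.+1 -> 'M[C]_#|X|) (x : X) (W : {vspace 'cV[C]_#|X|}) :
    {d : nat & 'M[C]_d.+1} :=
  Tagged (fun d => 'M[C]_d.+1)
    (tridiag_mx E (dual_adj E x)
       (dual_endpoint E W)
       (mximg (ext0 (dual_idem C Y x) (endpoint Y x W)%:Z) W)
       (diameter Y x W)).

(* Main.v *)
Require Import Defs.
From mathcomp Require Import boolp classical_sets.
From mathcomp Require Import all_boot all_order all_algebra zify ring.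

(* On an irreducible T-module [W] the matrices [A] and [A^*] act irreducibly, each
   one tridiagonally on the eigenspaces of the other, so [W] splits as in the
   theory of tridiagonal pairs ([irred_split]).
   Let [S] be the sum of the [(-1)^i E^*_i].  As [Y] is almost-bipartite,
   [A S + S A = 2 (-1)^D E^*_D A E^*_D], and evaluating this between two primitive
   idempotents shows that [theta_i + theta_j <> 0] for all [i, j].  Hence [E^*_D] is
   injective on each [E_i V], so that [E^*_D W <> 0] and [r + d = D]: (ii) and (iii)
   say the same.  Moreover [dim E_i W <= dim E^*_D W <= dim E_t W], and [E^*_h]
   is injective on [E_t W] for [h >= r]; counting dimensions, [E^*_h W = E^*_h E_t W].
   For [v] in [E_t W] the vector [(A - theta_t) A^* v] lies in [E_(t+1) W]; comparing
   its [E^*_h]-components gives inductively [R E^*_(h-1) v = c_h E^*_h v] with [c_h]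
   depending on [r] and [t] only.  So [r] and [t] determine the action of [A] and
   [A^*] on the [E^*_h v], which span [W].  Finally, [theta_t] is the sum of row 0 of
   [B(W)], so that [B(W)] determines [t] and [d]. *)

Set Implicit Arguments.
Unset Strict Implicit.
Unset Printing Implicit Defensive.

Import Order.TTheory GRing.Theory Num.Theory.
Local Open Scope ring_scope.

(** * Matrices acting tridiagonally on the eigenspaces of one another *)

Section Subspaces.
Context (C : fieldType) (n : nat).
Implicit Types (B : 'M[C]_n) (U W : {vspace 'cV[C]_n}) (w : 'cV[C]_n).

Definition stable B W := forall w, w \in W -> B *m w \in W.

Lemma mximgP B W w :
  reflect (exists2 u, u \in W & w = B *m u) (w \in mximg B W).
Proof.
apply: (iffP memv_imgP) => -[u Wu ->]; exists u => //; by rewrite lfunE.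
Qed.

Lemma mem_mximg B W w : w \in W -> B *m w \in mximg B W.
Proof. by move=> Ww; apply/mximgP; exists w. Qed.

Lemma mximg_eq0 B W :
  reflect (forall w, w \in W -> B *m w = 0) (mximg B W == 0%VS).
Proof.
apply: (iffP eqP) => [W0 w /(mem_mximg B) | W0].
  by rewrite W0 memv0 => /eqP.
apply/eqP; rewrite -subv0; apply/subvP => w /mximgP[u Wu ->].
by rewrite W0 // mem0v.
Qed.

Lemma mximg_neq0 B W :
  mximg B W != 0%VS -> exists2 w, w \in W & B *m w != 0.
Proof.
rewrite -vpick0 => nz; have /mximgP[u Wu def] := memv_pick (mximg B W).
by exists u; rewrite // -def.
Qed.

Lemma mximg_sub B W U : (forall w, w \in W -> B *m w \in U) -> (mximg B W <= U)%VS.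
Proof. by move=> BW; apply/subvP => w /mximgP[u Wu ->]; apply: BW. Qed.

Lemma dim_mximg_inj B W U :
  (forall w, w \in W -> B *m w \in U) ->
  (forall w, w \in W -> B *m w = 0 -> w = 0) -> (\dim W <= \dim U)%N.
Proof.
move=> BW injB; rewrite -(@limg_dim_eq _ _ _ (linfun (mulmx B)) W).
  exact/dimvS/mximg_sub.
apply/eqP; rewrite -subv0; apply/subvP => w /memv_capP[Ww].
by rewrite memv_ker lfunE /= => /eqP/injB->; rewrite ?mem0v.
Qed.

End Subspaces.

(** One half of a tridiagonal pair: [F i] is the eigenprojection of [A] for [th i], and [B] sends
    each eigenspace into the sum of itself and its neighbours. It is used for A, E_i, A^* and, with
    the roles exchanged, for A^*, E^*_i, A. *)
Record eigen_tridiag (C : fieldType) n D (A : 'M[C]_n) (F : 'I_D.+1 -> 'M[C]_n)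
    (th : 'I_D.+1 -> C) (B : 'M[C]_n) : Prop := EigenTridiag {
  et_idem : forall i j, F i *m F j = if i == j then F i else 0;
  et_sum : \sum_i F i = 1%:M;
  et_eig : A = \sum_i th i *: F i;
  et_inj : injective th;
  et_tri : forall i j : 'I_D.+1,
    (i.+1 < j)%N || (j.+1 < i)%N -> F i *m B *m F j = 0
}.

(** Irreducibility under the two matrices alone; by [T_moduleP] the subspaces stable under A and A^*
    are exactly the T-modules. *)
Definition irred (C : fieldType) n (A B : 'M[C]_n) (W : {vspace 'cV[C]_n}) :=
  [/\ stable A W, stable B W, W <> 0%VS &
      forall U, stable A U -> stable B U -> (U <= W)%VS -> U = 0%VS \/ U = W].

Lemma irredC (C : fieldType) n (A B : 'M[C]_n) W : irred A B W -> irred B A W.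
Proof. by case=> sA sB W0 Wirr; split=> // U sBU sAU; apply: Wirr. Qed.

Section EigenTridiag.
Context (C : fieldType) (n D : nat) (A : 'M[C]_n) (F : 'I_D.+1 -> 'M[C]_n).
Context (th : 'I_D.+1 -> C) (B : 'M[C]_n) (hF : eigen_tridiag A F th B).
Implicit Types (W U : {vspace 'cV[C]_n}) (w : 'cV[C]_n) (i j k l : 'I_D.+1).

(** Lets the split argument run from the upper end of the spectrum. *)
Lemma et_rev :
  eigen_tridiag A (F \o @rev_ord D.+1) (th \o @rev_ord D.+1) B.
Proof.
have [idF sF eF iF tF] := hF; split.
- by move=> i j; rewrite /= idF (inj_eq rev_ord_inj).
- by rewrite -sF [RHS](reindex_inj rev_ord_inj).
- by rewrite eF [LHS](reindex_inj rev_ord_inj).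
- by move=> i j /iF /rev_ord_inj.
- move=> i j ij; apply: tF => /=.
  move: ij (ltn_ord i) (ltn_ord j). lia.
Qed.

Lemma et_idemA k : F k *m A = th k *: F k.
Proof.
have [idF _ -> _ _] := hF; rewrite mulmx_sumr (bigD1 k) //= big1 => [|j jk].
  by rewrite addr0 -scalemxAr idF eqxx.
by rewrite -scalemxAr idF eq_sym (negPf jk) scaler0.
Qed.

Lemma et_Aidem k : A *m F k = th k *: F k.
Proof.
have [idF _ -> _ _] := hF; rewrite mulmx_suml (bigD1 k) //= big1 => [|j jk].
  by rewrite addr0 -scalemxAl idF eqxx.
by rewrite -scalemxAl idF (negPf jk) scaler0.
Qed.

Lemma et_dec w : w = \sum_k F k *m w.
Proof. by rewrite -mulmx_suml (et_sum hF) mul1mx. Qed.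

Lemma et_eq0 w : (forall k, F k *m w = 0) -> w = 0.
Proof. by move=> w0; rewrite (et_dec w) big1. Qed.

Lemma et_neq j k w : j != k -> F j *m (F k *m w) = 0.
Proof. by move=> jk; rewrite mulmxA (et_idem hF) (negPf jk) mul0mx. Qed.

Lemma et_id k w : F k *m (F k *m w) = F k *m w.
Proof. by rewrite mulmxA (et_idem hF) eqxx. Qed.

Lemma et_FA k w : F k *m (A *m w) = th k *: (F k *m w).
Proof. by rewrite mulmxA et_idemA scalemxAl. Qed.

Lemma et_FB k w : F k *m (B *m w) = \sum_l F k *m (B *m (F l *m w)).
Proof. by rewrite {1}(et_dec w) !mulmx_sumr. Qed.

Lemma et_tri0 k l w : (k.+1 < l)%N || (l.+1 < k)%N -> F k *m (B *m (F l *m w)) = 0.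
Proof. by move=> kl; rewrite 2!mulmxA (et_tri hF) // mul0mx. Qed.

Lemma et_FB0 k w :
  (forall l : 'I_D.+1, (l <= k.+1)%N && (k <= l.+1)%N -> F l *m w = 0) -> F k *m (B *m w) = 0.
Proof.
move=> w0; rewrite et_FB big1 // => l _.
have [lk|lk] := boolP ((l <= k.+1)%N && (k <= l.+1)%N).
  by rewrite w0 ?mulmx0.
by apply: et_tri0; lia.
Qed.

(** The monic polynomial in [A] with roots [s], applied to [w]. *)
Definition annih (s : seq C) w := foldr (fun c u => A *m u - c *: u) w s.

Lemma annihE s w :
  annih s w = \sum_k (\prod_(c <- s) (th k - c)) *: (F k *m w).
Proof.
elim: s => [|c s IHs] /=.
  by rewrite [LHS]et_dec; under [RHS]eq_bigr do rewrite big_nil scale1r.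
rewrite /annih /= -/(annih s w) IHs mulmx_sumr scaler_sumr -sumrB.
apply: eq_bigr => k _; rewrite big_cons -scalemxAr mulmxA et_Aidem -scalemxAl.
by rewrite !scalerA -scalerBl; congr (_ *: _); ring.
Qed.

(** Lagrange interpolation: the product of the [A - th j] over [j != k] kills every eigenspace but
    the [k]-th. Thus [F k] is a polynomial in [A]. *)
Lemma annih_isolate k :
  exists s c, c != 0 /\ forall w, annih s w = c *: (F k *m w).
Proof.
pose s := [seq th j | j <- enum 'I_D.+1 & j != k].
exists s, (\prod_(c <- s) (th k - c)); split=> [|w].
  rewrite prodf_seq_neq0; apply/allP => _ /mapP[j + ->] /=.
  rewrite mem_filter => /andP[jk _].
  by rewrite subr_eq0 (inj_eq (et_inj hF)) eq_sym.
rewrite annihE (bigD1 k) //= [X in _ + X]big1 ?addr0 // => j jk.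
rewrite big_map (perm_big _ (perm_to_rem (_ : j \in _))) /=.
  by rewrite big_cons subrr mul0r scale0r.
by rewrite mem_filter jk mem_enum.
Qed.

Lemma et_stable W k : stable A W -> stable (F k) W.
Proof.
move=> sA w Ww; have [s [c [c0 sE]]] := annih_isolate k.
rewrite -(scalerK c0 (F k *m w)) -sE memvZ // {sE}.
by elim: s => //= c' s IHs; rewrite memvB ?memvZ ?sA.
Qed.

(** [F k] is a polynomial in [A], but [phi] commutes with [A] on [W] only, so the induction also
    keeps each partial product inside [W]. *)
Lemma et_comm W (phi : 'M[C]_n) k : stable A W ->
  (forall w, w \in W -> phi *m (A *m w) = A *m (phi *m w)) ->
  forall w, w \in W -> phi *m (F k *m w) = F k *m (phi *m w).
Proof.
move=> sA phiA w Ww; have [s [c [c0 sE]]] := annih_isolate k.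
apply: (scalerI c0); rewrite scalemxAr -!sE {sE}.
have sW : annih s w \in W /\ phi *m annih s w = annih s (phi *m w).
  elim: s => //= c' s [IHs sphi]; split; first by rewrite memvB ?memvZ ?sA.
  by rewrite mulmxBr -scalemxAr phiA // sphi.
by case: sW.
Qed.

Lemma et_dim W : stable A W -> \dim W = (\sum_k \dim (mximg (F k) W))%N.
Proof.
move=> sA; have defW : (\sum_k mximg (F k) W)%VS = W.
  apply: subv_anti; apply/andP; split.
    by apply/subv_sumP => k _; apply: mximg_sub; apply: et_stable.
  by apply/subvP => w Ww; rewrite (et_dec w) memv_sumr // => k _; apply: mem_mximg.
rewrite -{1}defW; apply/eqP.
have /directvP/= -> // : directv (\sum_k mximg (F k) W)%VS.
apply/directv_sum_independent => us Fus sum0 k _.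
have fix_us j : F j *m us j = us j.
  by have /mximgP[u _ ->] := Fus j isT; rewrite et_id.
have : F k *m \sum_j us j = 0 by rewrite sum0 mulmx0.
rewrite mulmx_sumr (bigD1 k) //= big1 ?addr0 ?fix_us // => j jk.
by rewrite -(fix_us j) et_neq // eq_sym.
Qed.

End EigenTridiag.

(** * Subspaces defined by vanishing components, and the split argument *)

Definition vanish (C : fieldType) n D (F : 'I_D.+1 -> 'M[C]_n) (P : pred 'I_D.+1)
    (W : {vspace 'cV[C]_n}) : {vspace 'cV[C]_n} :=
  (W :&: lker (linfun (mulmx (\sum_(k | P k) F k) : 'cV[C]_n -> 'cV[C]_n)))%VS.

(** One kernel encodes all the conditions, since [F k] isolates the [k]-th term of the sum. *)
Lemma vanishP (C : fieldType) n D (A : 'M[C]_n) (F : 'I_D.+1 -> 'M[C]_n) th B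
    (hF : eigen_tridiag A F th B) (P : pred 'I_D.+1) (W : {vspace 'cV[C]_n}) w :
  reflect (w \in W /\ forall k, P k -> F k *m w = 0) (w \in vanish F P W).
Proof.
rewrite memv_cap memv_ker lfunE /= mulmx_suml.
apply: (iffP andP) => -[Ww w0]; split=> //; last by apply/eqP/big1.
move=> k Pk; have /(congr1 (mulmx (F k))) := eqP w0.
rewrite mulmx0 mulmx_sumr (bigD1 k) //= (et_id hF) big1 ?addr0 // => j /andP[_ jk].
by rewrite (et_neq hF) // eq_sym.
Qed.

(* With [V_m] the set of [w] in [W] with no [F]-component of index at least [m]
   and no [G]-component of index below [m + (i - j)], one has
   [(A - th_(m-1)) V_m <= V_(m-1)] and [(B - ths_(m+i-j)) V_m <= V_(m+1)], so the
   sum of the [V_m] is a submodule; it is proper as it avoids the index [r]. *)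
Lemma irred_split (C : fieldType) n D (A B : 'M[C]_n) (F G : 'I_D.+1 -> 'M[C]_n)
    th ths (hF : eigen_tridiag A F th B) (hG : eigen_tridiag B G ths A)
    (W : {vspace 'cV[C]_n}) (t : nat) (r : 'I_D.+1) (i j : nat) w :
  irred A B W ->
  (forall k : 'I_D.+1, (k < t)%N -> forall u, u \in W -> F k *m u = 0) ->
  (exists2 u, u \in W & G r *m u != 0) ->
  (j + r <= i + t)%N ->
  w \in W ->
  (forall h : 'I_D.+1, (h < i)%N -> G h *m w = 0) ->
  (forall k : 'I_D.+1, (j <= k)%N -> F k *m w = 0) ->
  w = 0.
Proof.
case=> sA sB W0 Wirr tP [u Wu Gu] ij Ww Gw Fw.
(* Subtraction is truncated: while m + i <= j, no condition is put on the [G]-components. *)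
pose V m := vanish F [pred k : 'I_D.+1 | m <= k]%N
              (vanish G [pred h : 'I_D.+1 | h < m + i - j]%N W).
have VP m v : reflect [/\ v \in W, forall h : 'I_D.+1, (h < m + i - j)%N -> G h *m v = 0
    & forall k : 'I_D.+1, (m <= k)%N -> F k *m v = 0] (v \in V m).
  apply: (iffP (vanishP hF _ _ _)) => [[/(vanishP hG)[]] | []] //.
  by move=> Wv Gv Fv; split=> //; apply/(vanishP hG).
pose U := (\sum_(m < D.+2) V m)%VS.
have VU m : (V m <= U)%VS.
  have [mD|Dm] := ltnP m D.+2; first by rewrite (sumv_sup (Ordinal mD)).
  rewrite (sumv_sup ord_max) //; apply/subvP => v /VP[Wv Gv Fv]; apply/VP; split=> //=.
    by move=> h hi; apply: Gv; lia.
  by move=> k; have := ltn_ord k; lia.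
have sumU (M : 'M[C]_n) : (forall m v, v \in V m -> M *m v \in U) -> stable M U.
  move=> MV v /memv_sumP[vs Vvs ->]; rewrite mulmx_sumr; apply: memv_suml => m _.
  by apply: MV (Vvs m isT).
have sAU : stable A U.
  apply: sumU => -[|m] v /[dup] Vv /VP[Wv Gv Fv].
    by rewrite (et_eq0 hF (w := v)) ?mulmx0 ?mem0v // => k; apply: Fv.
  pose c := th (inord m); rewrite -(subrK (c *: v) (A *m v)) memvD //; last first.
    by rewrite memvZ // (subvP (VU m.+1)).
  apply: (subvP (VU m)); apply/VP; split.
  - by rewrite memvB ?memvZ ?sA.
  - move=> h hi; rewrite mulmxBr -scalemxAr Gv ?scaler0 ?subr0; last by lia.
    by apply: (et_FB0 hG) => l /andP[lh _]; apply: Gv; lia.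
  - move=> k mk; rewrite mulmxBr -scalemxAr (et_FA hF) -scalerBl.
    have [mk'|km] := ltnP m k; first by rewrite Fv ?scaler0.
    have -> : k = inord m by apply: ord_inj; rewrite inordK; have := ltn_ord k; lia.
    by rewrite subrr scale0r.
have sBU : stable B U.
  apply: sumU => m v /[dup] Vv /VP[Wv Gv Fv].
  pose c := ths (inord (m + i - j)); rewrite -(subrK (c *: v) (B *m v)) memvD //; last first.
    by rewrite memvZ // (subvP (VU m)).
  apply: (subvP (VU m.+1)); apply/VP; split.
  - by rewrite memvB ?memvZ ?sB.
  - move=> h hi; rewrite mulmxBr -scalemxAr (et_FA hG) -scalerBl.
    have [hi'|ih] := ltnP h (m + i - j); first by rewrite Gv ?scaler0.
    have -> : h = inord (m + i - j) by apply: ord_inj; rewrite inordK; have := ltn_ord h; lia.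
    by rewrite subrr scale0r.
  - move=> k mk; rewrite mulmxBr -scalemxAr Fv ?scaler0 ?subr0; last by lia.
    by apply: (et_FB0 hF) => l /andP[_ kl]; apply: Fv; lia.
have UW : (U <= W)%VS by apply/subv_sumP => m _; apply/subvP => v /VP[].
have Gr0 v : v \in U -> G r *m v = 0.
  case/memv_sumP=> vs Vvs ->; rewrite mulmx_sumr big1 // => m _.
  (* If m <= t, the vector has no [F]-component at all and is 0; if m > t, the index r lies below m
     + i - j. *)
  have /VP[Wv Gv Fv] := Vvs m isT; have [mt|tm] := leqP m t; last by apply: Gv; lia.
  rewrite (et_eq0 hF (w := vs m)) ?mulmx0 // => k.
  by have [/tP->|tk] := ltnP k t; rewrite ?Fv //; lia.
have [U0|UeqW] := Wirr U sAU sBU UW; last by rewrite -UeqW in Wu; rewrite Gr0 ?eqxx in Gu.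
by apply/eqP; rewrite -memv0 -U0; apply: (subvP (VU j)); apply/VP; split=> // h hi; apply: Gw; lia.
Qed.

(** Each factor [B - c] raises the highest [F]-index by at most one. *)
Lemma annih_vanish (C : fieldType) n D (A B : 'M[C]_n) (F : 'I_D.+1 -> 'M[C]_n)
    th (hF : eigen_tridiag A F th B) s m w :
  (forall k : 'I_D.+1, (m <= k)%N -> F k *m w = 0) ->
  forall k : 'I_D.+1, (m + size s <= k)%N -> F k *m annih B s w = 0.
Proof.
move=> w0; elim: s => [|c s IHs] k /= mk; first by apply: w0; lia.
rewrite /annih /= -/(annih B s w) mulmxBr -scalemxAr IHs ?scaler0 ?subr0; last by lia.
by apply: (et_FB0 hF) => l /andP[_ kl]; apply: IHs; lia.
Qed.

(** * Irreducible modules with given endpoint and dual endpoint *)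

Section AlmostBipartite.
Context (C : fieldType) (n D : nat) (A B : 'M[C]_n) (F G : 'I_D.+1 -> 'M[C]_n).
Context (th ths : 'I_D.+1 -> C).
Context (hF : eigen_tridiag A F th B) (hG : eigen_tridiag B G ths A).
Context (Gflat : forall i : 'I_D.+1, (i < D)%N -> G i *m A *m G i = 0).
Context (Finj : forall k (w : 'cV[C]_n), F k *m w = w -> G ord_max *m w = 0 -> w = 0).
Context (r t : 'I_D.+1).
Implicit Types (W : {vspace 'cV[C]_n}) (v w : 'cV[C]_n).

(* [W] is an irreducible module with endpoint [r] and dual endpoint [t]. *)
Definition irred_at (W : {vspace 'cV[C]_n}) :=
  [/\ irred A B W,
      forall h : 'I_D.+1, (h < r)%N -> forall w, w \in W -> G h *m w = 0,
      exists2 w, w \in W & G r *m w != 0,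
      forall k : 'I_D.+1, (k < t)%N -> forall w, w \in W -> F k *m w = 0 &
      exists2 w, w \in W & F t *m w != 0].

(** For h < D, the product of the [B - ths j] over r <= j < D, j != h, kills all [G]-components of
    [v] but the last, the one at h being 0 already. So a nonzero multiple of the last component is a
    polynomial of degree D - r - 1 in [B] applied to [v]: its [F]-components from t + (D - r) on
    vanish. By [irred_split] it is 0, and [Finj] applies. *)
Lemma idem_inj W (h : 'I_D.+1) v :
  irred_at W -> v \in W -> F t *m v = v -> (r <= h)%N -> G h *m v = 0 -> v = 0.
Proof.
move=> [Wirr Wr Wr0 Wt Wt0] Wv Ftv rh Ghv; apply: (Finj Ftv).
have [hD|Dh] := eqVneq h ord_max; first by rewrite -hD.
have hltD : (h < D)%N by rewrite ltn_neqAle -ltnS ltn_ord andbT.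
pose js := rem (h : nat) (iota r (D - r)).
have mem_js j : (j \in js) = [&& r <= j, j < D & j != h]%N.
  by rewrite mem_rem_uniq ?iota_uniq // !inE mem_iota; lia.
pose s := [seq ths (inord j) | j <- js].
have [c c0 Ew] : exists2 c, c != 0 & annih B s v = c *: (G ord_max *m v).
  exists (\prod_(c <- s) (ths ord_max - c)).
    rewrite prodf_seq_neq0; apply/allP => _ /mapP[j + ->] /=.
    rewrite mem_js => /and3P[_ jD _].
    rewrite subr_eq0 (inj_eq (et_inj hG)) -val_eqE /= inordK; lia.
  rewrite (annihE hG) (bigD1 ord_max) //= [X in _ + X]big1 ?addr0 // => j jD.
  have [->|jh] := eqVneq j h; first by rewrite Ghv scaler0.
  have [jr|rj] := ltnP j r; first by rewrite Wr ?scaler0.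
  rewrite big_map (perm_big _ (perm_to_rem (_ : (j : nat) \in js))) /=.
    by rewrite big_cons inord_val subrr mul0r scale0r.
  by rewrite mem_js rj jh !andbT ltn_neqAle -ltnS ltn_ord andbT.
have sz : size s = (D - r).-1.
  by rewrite size_map size_rem ?size_iota // mem_iota; lia.
rewrite -(scalerK c0 (G ord_max *m v)) -Ew.
suff -> : annih B s v = 0 by rewrite scaler0.
apply: (irred_split hF hG (t := t) (r := r) (i := D) (j := t + (D - r)) Wirr) => //.
- by have := ltn_ord r; lia.
- rewrite Ew memvZ //; apply: (et_stable hG) => //; by case: Wirr.
- move=> k kD; rewrite Ew -scalemxAr (et_neq hG) ?scaler0 //.
  by rewrite -val_eqE /=; lia.
- move=> k tk; apply: (annih_vanish hF (m := t.+1)); last by rewrite sz; lia.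
  move=> l tl; rewrite -Ftv (et_neq hF) //; rewrite -val_eqE /=; lia.
Qed.

(** Bounds the number of nonzero [F k] W by D - r + 1. The split argument is run with the two
    families exchanged, on a vector of [F k] W; no [G]-index reaches D + 1. *)
Lemma idem_above W (k : 'I_D.+1) w :
  irred_at W -> w \in W -> (t + (D - r) < k)%N -> F k *m w = 0.
Proof.
move=> [Wirr Wr Wr0 Wt Wt0] Ww tk; have [sA _ _ _] := Wirr.
apply: (irred_split hG hF (t := r) (r := t) (i := k) (j := D.+1) (irredC Wirr)) => //.
- by have := ltn_ord r; lia.
- exact: (et_stable hF).
- move=> h hk; rewrite (et_neq hF) //; rewrite -val_eqE /=; lia.
- by move=> h; have := ltn_ord h; lia.
Qed.

(** With [Finj], this bounds the dimension of each [F k] W by that of [F t] W. The split argument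
    runs with the [F]-order reversed, where [idem_above] supplies the starting index. *)
Lemma idem_top_inj W f :
  irred_at W -> f \in W -> G ord_max *m f = f -> F t *m f = 0 -> f = 0.
Proof.
move=> Wat Wf Gf Ff; have [Wirr Wr Wr0 Wt Wt0] := Wat.
apply: (irred_split (et_rev hF) hG (t := D - (t + (D - r))) (r := r) (i := D)
  (j := D - t) Wirr) => //.
- move=> k kD w Ww /=; apply: (idem_above Wat) => //=; lia.
- by have := ltn_ord r; have := ltn_ord t; lia.
- move=> h hD; rewrite -Gf (et_neq hG) // -val_eqE /=; lia.
- move=> k kD /=; have [kt|kt] := eqVneq (rev_ord k) t; first by rewrite kt.
  by apply: Wt => //; move: kt; rewrite -val_eqE /=; have := ltn_ord k; lia.
Qed.

(** At most D - r + 1 of the [F k] W are nonzero, each of dimension at most [n0]; the D - r + 1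
    spaces [G k] W with k >= r have dimension at least [n0]. Both families add up to the dimension
    of W, so equality holds throughout and the injection of [F t] W into [G h] W is onto. *)
Lemma idem_surj W (h : 'I_D.+1) w :
  irred_at W -> (r <= h)%N -> w \in W ->
  exists v, [/\ v \in W, F t *m v = v & G h *m w = G h *m v].
Proof.
move=> Wat rh Ww; have [[sA sB _ _] Wr Wr0 Wt Wt0] := Wat.
pose n0 : nat := \dim (mximg (F t) W).
have WF k u : u \in mximg (F k) W -> u \in W /\ F k *m u = u.
  by case/mximgP=> u' Wu' ->; rewrite (et_id hF) (et_stable hF).
have WG k u : u \in mximg (G k) W -> u \in W /\ G k *m u = u.
  by case/mximgP=> u' Wu' ->; rewrite (et_id hG) (et_stable hG).
have dimF k : (\dim (mximg (F k) W) <= n0)%N.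
  apply: (@leq_trans (\dim (mximg (G ord_max) W))).
    apply: (dim_mximg_inj (B := G ord_max)) => u /WF[Wu Fu]; first exact: mem_mximg.
    exact: Finj Fu.
  apply: (dim_mximg_inj (B := F t)) => u /WG[Wu Gu]; first exact: mem_mximg.
  exact: idem_top_inj Wat Wu Gu.
have dimG (k : 'I_D.+1) : (r <= k)%N -> (n0 <= \dim (mximg (G k) W))%N.
  move=> rk; apply: (dim_mximg_inj (B := G k)) => u /WF[Wu Fu]; first exact: mem_mximg.
  exact: idem_inj Wat Wu Fu rk.
have sumF : (\sum_k \dim (mximg (F k) W) <= \sum_(k : 'I_D.+1 | r <= k) n0)%N.
  rewrite (bigID [pred k : 'I_D.+1 | t <= k <= t + (D - r)]%N) /= addnC big1 => [|k tk].
    rewrite add0n (leq_trans (leq_sum _ (fun k _ => dimF k))) //.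
    rewrite !sum_nat_const leq_mul2r; apply/orP; right.
    (* The shift by r - t injects the indices from t to t + (D - r) into those from r to D. *)
    pose f (k : 'I_D.+1) : 'I_D.+1 := inord (k - t + r).
    rewrite -(card_in_image (f := f)) => [|k l]; last first.
      move=> /andP[tk tk'] /andP[tl tl'] /(congr1 val); rewrite /= !inordK; try by have := ltn_ord r; lia.
      by move=> kl; apply: ord_inj; lia.
    apply/subset_leq_card/subsetP => _ /imageP[k tk ->].
    by rewrite unfold_in /f inordK; move: tk => /andP[]; have := ltn_ord r; lia.
  apply/eqP; rewrite dimv_eq0; apply/mximg_eq0 => u Wu.
  have [kt|tk'] := ltnP k t; first exact: Wt.
  by apply: idem_above Wat Wu _; lia.
have dimGh : \dim (mximg (G h) W) = n0.
  apply/eqP; rewrite eqn_leq dimG // andbT.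
  move: sumF; rewrite -(et_dim hF sA) (et_dim hG sB) (bigID [pred k : 'I_D.+1 | r <= k]%N) /=.
  rewrite (bigD1 h) //= [X in (_ <= X)%N](bigD1 h) //=.
  have : (\sum_(k < D.+1 | (r <= k)%N && (k != h)) n0 <=
    \sum_(k < D.+1 | (r <= k)%N && (k != h)) \dim (mximg (G k) W))%N.
    by apply: leq_sum => k /andP[rk _]; apply: dimG.
  move=> le1 le2; rewrite -(leq_add2r (\sum_(k < D.+1 | (r <= k)%N && (k != h)) n0)).
  by apply: leq_trans le2; rewrite -addnA leq_add2l (leq_trans le1) ?leq_addr.
have GFW : mximg (G h) (mximg (F t) W) = mximg (G h) W.
  apply/eqP; rewrite eqEdim dimGh; apply/andP; split.
    by apply: mximg_sub => u /WF[Wu _]; apply: mem_mximg.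
  apply: (dim_mximg_inj (B := G h)) => u FWu; first exact: mem_mximg.
  by have [Wu Fu] := WF _ _ FWu; apply: (idem_inj Wat Wu Fu rh).
have : G h *m w \in mximg (G h) (mximg (F t) W) by rewrite GFW mem_mximg.
by case/mximgP => v /WF[Wv Fv] ->; exists v.
Qed.

(** Otherwise the vectors without components at levels up to [h] form a submodule. It is not W,
    because of level [r]; it is not 0, because it contains [G ord_max] W, which is nonzero by
    [Finj]. *)
Lemma lowering_neq0 W (h : 'I_D.+1) :
  irred_at W -> (r <= h)%N -> (h < D)%N ->
  ~ (forall w, w \in W -> G h *m (A *m (G (inord h.+1) *m w)) = 0).
Proof.
move=> Wat rh hD low0; have [[sA sB W0 Wirr] Wr [w0 Ww0 Gw0] Wt [w1 Ww1 Fw1]] := Wat.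
have hS : (inord h.+1 : 'I_D.+1) = h.+1 :> nat by rewrite inordK.
pose U := vanish G [pred l : 'I_D.+1 | l <= h]%N W.
have UP v : reflect (v \in W /\ forall l : 'I_D.+1, (l <= h)%N -> G l *m v = 0) (v \in U).
  exact: (vanishP hG).
have sAU : stable A U.
  move=> v /UP[Wv Gv]; apply/UP; split=> [|l lh]; first exact: sA.
  have [lh'|hl] := ltnP l h.
    by apply: (et_FB0 hG) => k /andP[kl _]; apply: Gv; lia.
  have -> : l = h by apply: ord_inj; lia.
  rewrite (et_FB hG) (bigD1 (inord h.+1)) //= low0 // add0r big1 // => k kh.
  have [kh'|hk] := leqP k h; first by rewrite Gv ?mulmx0.
  by apply: (et_tri0 hG); move: kh; rewrite -val_eqE /= hS; lia.
have sBU : stable B U.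
  move=> v /UP[Wv Gv]; apply/UP; split=> [|l lh]; first exact: sB.
  by rewrite (et_FA hG) Gv ?scaler0.
have [|U0|UW] := Wirr U sAU sBU; first by apply/subvP => v /UP[].
  have GW v : v \in W -> G ord_max *m v = 0.
    move=> Wv; apply/eqP; rewrite -memv0 -U0; apply/UP.
    split=> [|l lh]; first exact: (et_stable hG).
    by rewrite (et_neq hG) // -val_eqE /=; lia.
  move/eqP: Fw1; apply; apply: (Finj (et_id hF _ _)).
  by apply: GW; apply: (et_stable hF).
by move: Ww0; rewrite -UW => /UP[_ /(_ r rh) Gw]; rewrite Gw eqxx in Gw0.
Qed.

(** Levels indexed by naturals: [Gn] is 0 beyond D, [Gp h] is level h - 1 and 0 at h = 0, and [s]
    repeats its last value beyond D. The three-term relation then has one form at both ends. *)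
Let Gn (h : nat) : 'M[C]_n := oapp G 0 (insub h).
Let Gp (h : nat) : 'M[C]_n := if h is h'.+1 then Gn h' else 0.
Let s (h : nat) : C := ths (inord (minn h D)).

Let GnE (h : 'I_D.+1) : Gn h = G h.
Proof. by rewrite /Gn valK. Qed.

Let Gn_big h : (D < h)%N -> Gn h = 0.
Proof. by move=> Dh; rewrite /Gn insubF //; lia. Qed.

Let GnGn (l : 'I_D.+1) m w : G l *m (Gn m *m w) = if l == m :> nat then G l *m w else 0.
Proof.
have [mD|Dm] := leqP m D; last first.
  by rewrite Gn_big // mul0mx mulmx0; case: eqP => // E; have := ltn_ord l; lia.
rewrite -(@inordK D m) // GnE; case: eqP => [E|lm].
  by rewrite -(ord_inj E) (et_id hG).
by rewrite (et_neq hG) // -val_eqE; apply/eqP.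
Qed.

Let GnB h w : Gn h *m (B *m w) = s h *: (Gn h *m w).
Proof.
have [hD|Dh] := leqP h D; last by rewrite Gn_big // !mul0mx scaler0.
by rewrite -(@inordK D h) // GnE (et_FA hG) /s inordK // (minn_idPl _) ?inord_val.
Qed.

Let GpB h w : Gp h *m (B *m w) = s h.-1 *: (Gp h *m w).
Proof. by case: h => [|h] /=; rewrite ?mul0mx ?scaler0. Qed.

Let Gtri h w : (h <= D)%N ->
  Gn h *m (A *m w) = Gn h *m (A *m (Gp h *m w)) + Gn h *m (A *m (Gn h *m w))
                     + Gn h *m (A *m (Gn h.+1 *m w)).
Proof.
move=> hD; rewrite -!mulmxDr -!mulmxDl; apply/eqP.
have Gh : Gn h = G (inord h) by rewrite -GnE inordK.
rewrite -subr_eq0 -!mulmxBr {1}Gh {Gh}.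
apply/eqP/(et_FB0 hG) => l; rewrite inordK // => lh; rewrite mulmxBr !mulmxDl !mulmxDr.
rewrite !GnGn; case: h hD lh => [|h] hD lh /=; rewrite ?mul0mx ?mulmx0 ?GnGn.
  have [->/=|[->/=|E]] : l = 0%N :> nat \/ l = 1%N :> nat \/ (1 < l)%N by lia.
  - by rewrite addr0 add0r subrr.
  - by rewrite !add0r subrr.
  - lia.
have [E|[E|E]] : l = h :> nat \/ l = h.+1 :> nat \/ l = h.+2 :> nat by lia.
- by rewrite E eqxx !ltn_eqF // !addr0 subrr.
- by rewrite E eqxx (gtn_eqF (ltnSn _)) (ltn_eqF (ltnSn _)) addr0 add0r subrr.
- by rewrite E eqxx !gtn_eqF // !add0r subrr.
Qed.

Let Gflat0 h w : (h < D)%N -> Gn h *m (A *m (Gn h *m w)) = 0.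
Proof.
move=> hD; rewrite -(@inordK D h); last exact: ltnW.
by rewrite GnE 2!mulmxA Gflat ?mul0mx // inordK // ltnW.
Qed.

Let u v := A *m (B *m v) - th t *: (B *m v).

(** The equation [A *m v = th t *: v] eliminates the contribution of level h + 1. *)
Let Gn_u h v : (h <= D)%N -> F t *m v = v ->
  Gn h *m u v = (s h.-1 - s h.+1) *: (Gn h *m (A *m (Gp h *m v)))
                + (s h.+1 - s h) *: (th t *: (Gn h *m v)).
Proof.
move=> hD Fv; have Av : A *m v = th t *: v by rewrite -Fv mulmxA (et_Aidem hF) scalemxAl.
rewrite mulmxBr (Gtri (B *m v)) // -scalemxAr GpB !GnB -!scalemxAr.
have := Gtri v hD; rewrite Av -!scalemxAr => E.
rewrite [X in _ - X]scalerA mulrC -scalerA E.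
(* The flat part survives only at h = D, where [s h.+1] equals [s h] by truncation. *)
have q0 : (s h.+1 - s h) *: (Gn h *m (A *m (Gn h *m v))) = 0.
  have [hD'|Dh] := ltnP h D; first by rewrite Gflat0 ?scaler0.
  by rewrite /s !(minn_idPr _) ?leqW // subrr scale0r.
rewrite !scalerDr q0.
move: (Gn h *m (A *m (Gp h *m v))) (Gn h *m (A *m (Gn h *m v))) (Gn h *m (A *m (Gn h.+1 *m v))).
by move=> p q m; apply/matrixP => i j; rewrite !mxE; ring.
Qed.

Let sub_s h : (h < D)%N -> s h - s h.+2 != 0.
Proof.
move=> hD; rewrite subr_eq0 /s (inj_eq (et_inj hG)) -val_eqE /= !inordK; lia.
Qed.

(** In W, [B *m v] has [F]-components at t and t + 1 only, and [A - th t] kills the first. For t = D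
    the vector [u v] is 0. *)
Let A_u W v : irred_at W -> v \in W -> F t *m v = v ->
  A *m u v = th (inord (minn t.+1 D)) *: u v.
Proof.
move=> [[_ sB _ _] _ _ Wt _] Wv Fv; set c := th _; apply/eqP; rewrite -subr_eq0; apply/eqP.
apply: (et_eq0 hF) => k; rewrite mulmxBr -scalemxAr (et_FA hF) -scalerBl.
rewrite mulmxBr -scalemxAr (et_FA hF) -scalerBl scalerA.
have [kt|tk] := ltnP k t; first by rewrite (Wt _ kt) ?scaler0 ?sB.
have [->|kt] := eqVneq k t; first by rewrite subrr mulr0 scale0r.
have [kt'|tk'] := leqP k t.+1.
  have -> : c = th k.
    congr th; apply: ord_inj; move: kt; rewrite -val_eqE /= => kt.
    by rewrite inordK; have := ltn_ord k; lia.
  by rewrite subrr mul0r scale0r.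
rewrite (et_FB0 hF) ?scaler0 // => l /andP[_ kl].
by rewrite -Fv (et_neq hF) // -val_eqE /=; lia.
Qed.

(* [c] and [g] do not depend on [W]: the vector [u v] is an eigenvector of [A],
   which turns the coefficients of [v] at levels up to [h] into the next one. *)
Let raising_scalar h : (h <= D)%N -> exists c g, forall W v,
  irred_at W -> v \in W -> F t *m v = v ->
  Gn h *m (A *m (Gp h *m v)) = c *: (Gn h *m v) /\ Gp h *m u v = g *: (Gp h *m v).
Proof.
elim: h => [|h IHh] hD.
  by exists 0, 0 => W v _ _ _; rewrite /= !mul0mx !mulmx0 !scale0r.
have [c [g cgP]] := IHh (ltnW hD).
have Gh w : Gn h *m w = G (inord h) *m w by rewrite -GnE inordK // ltnW.
have [hr|rh] := ltnP h r.
  exists 0, 0 => W v Wat Wv Fv; have [[sA sB _ _] Wr _ _ _] := Wat.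
  have Wu : u v \in W by rewrite memvB ?memvZ ?sA ?sB.
  have hr' : ((inord h : 'I_D.+1) < r)%N by rewrite inordK // ltnW.
  by rewrite /= !Gh !(Wr _ hr') // !mulmx0 !scale0r.
pose th0 := th t; pose th1 := th (inord (minn t.+1 D)).
(* [g'] is read off from [Gn_u] at level h, and [k] from the level-h component of
   [A *m u v = th1 *: u v] once the terms from levels h - 1 and h + 1 are computed. *)
pose g' := (s h.-1 - s h.+1) * c + (s h.+1 - s h) * th0.
pose k := th1 * g' - g * c - (s h.+2 - s h.+1) * th0 * (th0 - c).
exists (k / (s h - s h.+2) / (th0 - c)), g' => W v Wat Wv Fv.
have [[sA sB _ _] _ _ _ _] := Wat.
have GuE z : z \in W -> F t *m z = z -> Gn h *m u z = g' *: (Gn h *m z).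
  move=> Wz Fz; have [cz _] := cgP W z Wat Wz Fz.
  by rewrite Gn_u ?(ltnW hD) // cz !scalerA -scalerDl.
have NE z : z \in W -> F t *m z = z ->
    Gn h *m (A *m (Gn h.+1 *m z)) = (th0 - c) *: (Gn h *m z).
  move=> Wz Fz; have [cz _] := cgP W z Wat Wz Fz.
  have Az : A *m z = th t *: z by rewrite -Fz mulmxA (et_Aidem hF) scalemxAl.
  have := Gtri z (ltnW hD); rewrite Az -scalemxAr cz Gflat0 // addr0 => E.
  by rewrite scalerBl E addrC addKr.
split; last exact: GuE.
have Gh1 w : Gn h.+1 *m w = G (inord h.+1) *m w by rewrite -GnE inordK.
(* If [th0 = c], lowering from level h + 1 to h vanishes on [F t] W, hence on W by [idem_surj]. *)
have c0 : th0 - c != 0.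
  apply/eqP => c0.
  apply: (@lowering_neq0 W (inord h) Wat); rewrite inordK // 1?ltnW // => w Ww.
  have rh' : (r <= (inord h.+1 : 'I_D.+1))%N by rewrite inordK // leqW.
  have [z [Wz Fz ->]] := idem_surj Wat rh' Ww.
  by rewrite -Gh1 -Gh NE // c0 scale0r.
have rh' : (r <= (inord h.+1 : 'I_D.+1))%N by rewrite inordK // leqW.
have WGp : A *m (Gp h.+1 *m v) \in W.
  by apply: sA; rewrite /= Gh; apply: (et_stable hG).
(* The raised part of [v] at level h + 1 is that of some [z] in [F t] W. The level-h equation and
   [idem_inj] will make [z] a multiple of [v]. *)
have [z [Wz Fz]] := idem_surj Wat rh' WGp; rewrite -!Gh1 => zE.
have [cv gv] := cgP W v Wat Wv Fv.
have := Gtri (u v) (ltnW hD).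
rewrite (A_u Wat Wv Fv) -scalemxAr GuE // gv -!scalemxAr cv Gflat0 // scaler0 addr0 Gn_u //.
rewrite zE mulmxDr !scalemxAr mulmxDr -!scalemxAr !NE // => E.
have zk : Gn h *m (((s h - s h.+2) * (th0 - c)) *: z - k *: v) = 0.
  rewrite mulmxBr -!scalemxAr /k; move: E; rewrite -/th0 -/th1.
  move: (Gn h *m z) (Gn h *m v) => p q /matrixP E.
  apply/matrixP => i j; have := E i j; rewrite !mxE => /= Eij.
  rewrite -[RHS](subrr (th1 * (g' * q i j))) {1}Eij.
  ring.
have : ((s h - s h.+2) * (th0 - c)) *: z - k *: v = 0.
  apply: (idem_inj Wat _ _ (h := inord h)); rewrite ?memvB ?memvZ //.
  - by rewrite mulmxBr -!scalemxAr Fz Fv.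
  - by rewrite inordK // ltnW.
  - by rewrite -Gh.
move/eqP; rewrite subr_eq0 => /eqP zv.
have nz : (s h - s h.+2) * (th0 - c) != 0 by rewrite mulf_neq0 ?sub_s.
rewrite -[z](scalerK nz) zv -!scalemxAr scalerA; congr (_ *: _).
by rewrite invfM; ring.
Qed.

(** The raising coefficient at level l being [c], the eigenvalue equation for [v] forces [th t - c]
    for lowering when l < D, and for the flat part when l = D. *)
Lemma irred_coef (l h : 'I_D.+1) : exists a, forall W v,
  irred_at W -> v \in W -> F t *m v = v ->
  G l *m (A *m (G h *m v)) = a *: (G l *m v).
Proof.
have lD : (l <= D)%N by rewrite -ltnS.
have [c [g cgP]] := raising_scalar lD.
have [lh|lh] := boolP ((l.+1 < h)%N || (h.+1 < l)%N).
  by exists 0 => W v _ _ _; rewrite (et_tri0 hG) ?scale0r.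
have [lh'|lh'|/ord_inj lh'] := ltngtP l h.
- exists (th t - c) => W v Wat Wv Fv; have [cv _] := cgP W v Wat Wv Fv.
  have Av : A *m v = th t *: v by rewrite -{1}Fv mulmxA (et_Aidem hF) -scalemxAl Fv.
  have := Gtri v lD; rewrite Av -scalemxAr cv Gflat0; last by have := ltn_ord h; lia.
  have -> : l.+1 = h by lia.
  by rewrite addr0 !GnE scalerBl => ->; rewrite addrC addKr.
- exists c => W v Wat Wv Fv; have [cv _] := cgP W v Wat Wv Fv; move: cv.
  have -> : nat_of_ord l = h.+1 by lia.
  rewrite /= GnE; have -> : h.+1 = l by lia.
  by rewrite GnE.
- rewrite -lh'; have [lD'|Dl] := ltnP l D.
    exists 0 => W v Wat Wv Fv; rewrite scale0r.
    by rewrite -(GnE l) Gflat0.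
  exists (th t - c) => W v Wat Wv Fv; have [cv _] := cgP W v Wat Wv Fv.
  have Av : A *m v = th t *: v by rewrite -{1}Fv mulmxA (et_Aidem hF) -scalemxAl Fv.
  have := Gtri v lD; rewrite Av -scalemxAr cv (@Gn_big l.+1) // mul0mx !mulmx0 addr0.
  by rewrite !GnE scalerBl => ->; rewrite addrC addKr.
Qed.

(** The span of the [G h *m v] is stable under [B], being spanned by eigenvectors, and under [A] by
    [irred_coef]. *)
Lemma irred_span W v : irred_at W -> v \in W -> F t *m v = v -> v != 0 ->
  forall w, w \in W -> exists c : 'I_D.+1 -> C, w = \sum_h c h *: (G h *m v).
Proof.
move=> Wat Wv Fv v0; have [[sA sB _ Wirr] _ _ _ _] := Wat.
pose U := (\sum_h <[G h *m v]>)%VS.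
have GU h : G h *m v \in U by apply: (subvP (sumv_sup h _ (subvv _))); rewrite ?memv_line.
have UP w : w \in U -> exists c : 'I_D.+1 -> C, w = \sum_h c h *: (G h *m v).
  case/memv_sumP => vs Vvs ->.
  have /fin_all_exists[c cP] : forall h, exists c, vs h = c *: (G h *m v).
    by move=> h; apply/vlineP/Vvs.
  by exists c; apply: eq_bigr => h _.
have sAU : stable A U.
  move=> w /UP[c ->]; rewrite mulmx_sumr memv_suml // => h _.
  rewrite -scalemxAr memvZ // (et_dec hG (A *m _)) memv_suml // => l _.
  by have [a /(_ W v Wat Wv Fv)->] := irred_coef l h; rewrite memvZ.
have sBU : stable B U.
  move=> w /UP[c ->]; rewrite mulmx_sumr memv_suml // => h _.
  by rewrite -scalemxAr memvZ // mulmxA (et_Aidem hG) -scalemxAl memvZ.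
have UW : (U <= W)%VS.
  by apply/subv_sumP => h _; rewrite -memvE; apply: (et_stable hG).
have [U0|<-] := Wirr U sAU sBU UW; last exact: UP.
case/eqP: v0; apply: (et_eq0 hG) => h; apply/eqP.
by rewrite -memv0 -U0.
Qed.

(** [phi] sends [G h *m v] to [G h *m v']; it commutes with [A] on W because both modules share the
    coefficients of [irred_coef]. *)
Lemma irred_iso W W' : irred_at W -> irred_at W' ->
  exists phi : 'M[C]_n,
    [/\ forall w, w \in W -> phi *m w \in W',
        forall w, w \in W -> phi *m w = 0 -> w = 0,
        forall w, w \in W -> phi *m (A *m w) = A *m (phi *m w) &
        forall w, w \in W -> phi *m (B *m w) = B *m (phi *m w)].
Proof.
move=> Wat Wat'.
have pickv V : irred_at V -> exists v, [/\ v \in V, F t *m v = v & v != 0].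
  case=> [[sA _ _ _] _ _ _ [w Vw Fw]]; exists (F t *m w).
  by rewrite (et_stable hF) // (et_id hF).
have [v [Wv Fv v0]] := pickv W Wat; have [v' [Wv' Fv' v0']] := pickv W' Wat'.
(* A row vector dual to [G h *m v], used to write [phi] as one matrix. *)
have /fin_all_exists[rho rhoP] : forall h : 'I_D.+1, exists f : 'rV[C]_n,
    G h *m v = 0 \/ f *m (G h *m v) = 1%:M.
  move=> h; have [->|nz] := eqVneq (G h *m v) 0; first by exists 0; left.
  have /cV0Pn[i] := nz; move: (G h *m v) => g gi.
  exists ((g i 0)^-1 *: delta_mx 0 i); right; apply/matrixP => a b.
  by rewrite -scalemxAl -rowE !ord1 !mxE mulVf.
have Gv0 (h : 'I_D.+1) : G h *m v = 0 -> G h *m v' = 0.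
  have [hr|rh] := ltnP h r; first by case: Wat' => _ Wr' _ _ _ _; apply: Wr'.
  by move/(idem_inj Wat Wv Fv rh) => /eqP; rewrite (negPf v0).
pose phi := \sum_h (G h *m v') *m rho h *m G h.
have phiG h : phi *m (G h *m v) = G h *m v'.
  rewrite mulmx_suml (bigD1 h) //= big1 => [|k kh].
    rewrite addr0 -mulmxA (et_id hG) -mulmxA.
    by case: (rhoP h) => [Gh|->]; rewrite ?mulmx1 // Gh !mulmx0 Gv0.
  by rewrite -mulmxA (et_neq hG) // mulmx0.
have [[sA sB _ _] Wr _ _ _] := Wat; have [[sA' sB' _ _] Wr' _ _ _] := Wat'.
have spanW := irred_span Wat Wv Fv v0.
exists phi; split=> w /spanW[c ->].
- rewrite mulmx_sumr memv_suml // => h _; rewrite -scalemxAr phiG memvZ //.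
  exact: (et_stable hG).
- rewrite mulmx_sumr => c0; apply: big1 => h _.
  have := congr1 (mulmx (G h)) c0; rewrite mulmx0 mulmx_sumr (bigD1 h) //= big1 => [|k kh].
    rewrite addr0 -scalemxAr phiG -scalemxAr (et_id hG) => /eqP.
    rewrite scaler_eq0 => /orP[/eqP->|/eqP Gv']; first by rewrite scale0r.
    have [hr|rh] := ltnP h r; first by rewrite Wr ?scaler0.
    by case/eqP: v0'; apply: (idem_inj Wat' Wv' Fv' rh).
  by rewrite -scalemxAr phiG -scalemxAr (et_neq hG) ?scaler0 // eq_sym.
- rewrite !mulmx_sumr; apply: eq_bigr => h _; rewrite -!scalemxAr; congr (_ *: _).
  rewrite phiG (et_dec hG (A *m (G h *m v))) (et_dec hG (A *m (G h *m v'))) mulmx_sumr.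
  apply: eq_bigr => l _; have [a aP] := irred_coef l h.
  by rewrite (aP W) // (aP W') // -scalemxAr phiG.
- rewrite !mulmx_sumr; apply: eq_bigr => h _; rewrite -!scalemxAr; congr (_ *: _).
  have BG z : B *m (G h *m z) = ths h *: (G h *m z).
    by rewrite mulmxA (et_Aidem hG) scalemxAl.
  by rewrite phiG !BG -scalemxAr phiG.
Qed.

End AlmostBipartite.

(** * The alternating sign operator *)

Section SignOperator.
Context (C : fieldType) (n D : nat) (A B : 'M[C]_n) (F G : 'I_D.+1 -> 'M[C]_n).
Context (th ths : 'I_D.+1 -> C).
Context (hF : eigen_tridiag A F th B) (hG : eigen_tridiag B G ths A).
Context (Gflat : forall i : 'I_D.+1, (i < D)%N -> G i *m A *m G i = 0).

Let S : 'M[C]_n := \sum_(h < D.+1) (-1) ^+ h *: G h.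

Let GS (h : 'I_D.+1) (w : 'cV[C]_n) : G h *m (S *m w) = (-1) ^+ h *: (G h *m w).
Proof.
rewrite mulmx_suml mulmx_sumr (bigD1 h) //= big1 ?addr0 => [|k kh].
  by rewrite -scalemxAl -scalemxAr (et_id hG).
by rewrite -scalemxAl -scalemxAr (et_neq hG) ?scaler0 // eq_sym.
Qed.

(** Neighbouring levels carry opposite signs and cancel; the flat part, present at level D only, is
    doubled. *)
Lemma sign_anticommute (w : 'cV[C]_n) : A *m (S *m w) + S *m (A *m w) =
  ((-1) ^+ D *+ 2) *: (G ord_max *m (A *m (G ord_max *m w))).
Proof.
apply/eqP; rewrite -subr_eq0; apply/eqP/(et_eq0 hG) => l.
rewrite mulmxBr mulmxDr GS (et_FB hG _ (S *m w)) (et_FB hG _ w) scaler_sumr -big_split /=.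
rewrite (bigD1 l) //= big1 => [|k kl]; last first.
  rewrite GS -!scalemxAr -scalerDl.
  have [kl'|] := boolP ((k.+1 < l)%N || (l.+1 < k)%N).
    by rewrite (et_tri0 hG) ?scaler0 // orbC.
  rewrite negb_or -!leqNgt => /andP[lk kl'].
  have [->|->] : k = l.+1 :> nat \/ l = k.+1 :> nat.
    by move: kl; rewrite -val_eqE /=; lia.
    by rewrite exprS mulN1r addNr scale0r.
  by rewrite exprS mulN1r subrr scale0r.
rewrite addr0 GS -!scalemxAr -scalerDl -mulr2n.
have [->|lD] := eqVneq l ord_max; first by rewrite (et_id hG) subrr.
rewrite (et_neq hG) // scaler0 subr0 2!mulmxA Gflat ?mul0mx ?scaler0 //.
by rewrite ltn_neqAle -ltnS ltn_ord andbT.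
Qed.

(** Between [F k] and [F j], the anticommutator becomes [th k + th j] times [F k *m S *m F j]. *)
Lemma opposite_eigen_top j k (w : 'cV[C]_n) : th k + th j = 0 ->
  (2%:R : C) != 0 -> F k *m (G ord_max *m (A *m (G ord_max *m (F j *m w)))) = 0.
Proof.
move=> thkj two0; have := congr1 (mulmx (F k)) (sign_anticommute (F j *m w)).
rewrite mulmxDr (et_FA hF) (_ : A *m (F j *m w) = th j *: (F j *m w)); last first.
  by rewrite mulmxA (et_Aidem hF) scalemxAl.
rewrite -!scalemxAr -scalerDl thkj scale0r => /esym/eqP.
rewrite scaler_eq0 -mulr_natr mulf_eq0 (negPf two0) orbF signr_eq0.
by move/eqP.
Qed.

(** If the top component of [w] is 0, then [A] acts on [S *m w] as [- th k], which is no eigenvalue;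
    so [S *m w] is 0, and [S] is invertible. *)
Lemma top_inj : (forall j k, th j + th k != 0) ->
  forall k (w : 'cV[C]_n), F k *m w = w -> G ord_max *m w = 0 -> w = 0.
Proof.
move=> th_opp k w Fw Gw; have := sign_anticommute w.
rewrite Gw !mulmx0 scaler0 (_ : A *m w = th k *: w); last first.
  by rewrite -Fw mulmxA (et_Aidem hF) scalemxAl.
rewrite -scalemxAr => E.
have Sw0 : S *m w = 0.
  apply: (et_eq0 hF) => j; have := congr1 (mulmx (F j)) E.
  rewrite mulmxDr (et_FA hF) -scalemxAr -scalerDl mulmx0 => /eqP.
  by rewrite scaler_eq0 (negPf (th_opp _ _)) => /eqP.
apply: (et_eq0 hG) => h; apply/eqP; have := GS h w.
by rewrite Sw0 mulmx0 => /esym/eqP; rewrite scaler_eq0 signr_eq0.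
Qed.

End SignOperator.

(** * The Bose-Mesner algebra and its dual *)

Section Adjoint.
Context (C : numClosedFieldType) (n : nat).
Implicit Types (M N : 'M[C]_n).

Definition adjoint_mx M : 'M[C]_n := (map_mx Num.conj M)^T.

Lemma adjoint_mxM M N : adjoint_mx (M *m N) = adjoint_mx N *m adjoint_mx M.
Proof. by rewrite /adjoint_mx map_mxM trmx_mul. Qed.

Lemma adjoint_mxK : involutive adjoint_mx.
Proof. by move=> M; apply/matrixP => i j; rewrite !mxE conjCK. Qed.

Lemma mxtrace_adjoint_eq0 M : \tr (M *m adjoint_mx M) = 0 -> M = 0.
Proof.
have E i : (M *m adjoint_mx M) i i = \sum_j `|M i j| ^+ 2.
  by rewrite mxE; apply: eq_bigr => j _; rewrite !mxE normCK.
have ge0 i : 0 <= (M *m adjoint_mx M) i i.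
  by rewrite E sumr_ge0 // => j _; rewrite exprn_ge0.
move/psumr_eq0P => M0; apply/matrixP => i j; rewrite mxE.
have := M0 (fun i _ => ge0 i) i isT; rewrite E => /psumr_eq0P Mi0.
apply/eqP; rewrite -normr_eq0 -[_ == 0](expf_eq0 _ 2); apply/eqP/Mi0 => // k _.
by rewrite exprn_ge0.
Qed.

(** With N the adjoint of M, the product of M - MN with its adjoint is 0, so M = MN, which is
    self-adjoint. *)
Lemma normal_idem_self_adjoint M : M *m M = M ->
  M *m adjoint_mx M = adjoint_mx M *m M -> adjoint_mx M = M.
Proof.
move=> MM; set N := adjoint_mx M => MN.
have NN : N *m N = N by rewrite -adjoint_mxM MM.
have aMN : adjoint_mx (M *m N) = M *m N by rewrite adjoint_mxM adjoint_mxK.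
have M_MN : M = M *m N.
  apply/eqP; rewrite -subr_eq0; apply/eqP/mxtrace_adjoint_eq0.
  have -> : adjoint_mx (M - M *m N) = N - M *m N.
    by rewrite -{2}aMN /adjoint_mx; apply/matrixP => i j; rewrite !mxE rmorphB.
  rewrite mulmxBr !mulmxBl !mulmxA MM -(mulmxA _ _ M) -MN -(mulmxA M N N) NN.
  by rewrite !mulmxA MM -(mulmxA M N N) NN !subrr mxtrace0.
by rewrite [RHS]M_MN -aMN -M_MN.
Qed.

End Adjoint.

(* [mul] stands for multiplication by the element of index 1. *)
Lemma triangular_ind (C : fieldType) (V : lmodType C) D
    (f : 'I_D.+1 -> 'I_D.+1 -> 'I_D.+1 -> C) (a : 'I_D.+1 -> V) (mul : V -> V)
    (P : V -> Prop) :
  (0 < D)%N -> triangular f ->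
  P 0 -> (forall c u v, P u -> P v -> P (c *: u + v)) ->
  (forall h, mul (a h) = \sum_l f l (inord 1) h *: a l) ->
  P (a ord0) -> (forall h, P (a h) -> P (mul (a h))) ->
  forall h, P (a h).
Proof.
move=> D0 tri P0 Plin mulE Pa0 Pmul.
have i1 : (inord 1 : 'I_D.+1) = 1%N :> nat by rewrite inordK.
suff H m : forall h : 'I_D.+1, (h <= m)%N -> P (a h) by move=> h; apply: (H h).
elim: m => [|m IHm] h hm.
  by rewrite (_ : h = ord0) //; apply: ord_inj; move: hm; rewrite leqn0 => /eqP.
have [/IHm //|mh] := leqP h m.
have hS : h = m.+1 :> nat by lia.
have mD : (m < D.+1)%N by have := ltn_ord h; lia.
pose h' := Ordinal mD; have [_ fh] := tri h (inord 1) h'.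
have {}fh : f h (inord 1) h' != 0.
  by apply/eqP/fh; rewrite i1 hS /= add1n eqxx.
(* The expansion of [mul (a h')] has a nonzero coefficient at m + 1 and none above, so it can be
   solved for [a h]. *)
have -> : a h = (f h (inord 1) h')^-1 *: (mul (a h') - \sum_(l | l != h) f l (inord 1) h' *: a l).
  by rewrite mulE (bigD1 h) //= addrK scalerA mulVf ?scale1r.
have PD u v : P u -> P v -> P (u + v).
  by move=> Pu Pv; rewrite -[u]scale1r; apply: Plin.
have PZ c u : P u -> P (c *: u) by move=> Pu; rewrite -[_ *: _]addr0; apply: Plin.
apply/PZ/PD; first exact/Pmul/IHm.
rewrite -scaleN1r; apply: (PZ); elim/big_ind: _ => // l lh.
have [lm|ml] := leqP l m; first by apply/PZ/IHm.
have [f0 _] := tri l (inord 1) h'; rewrite f0 ?scale0r //.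
by rewrite i1 /=; move: lh; rewrite -val_eqE /= => lh; apply/orP; left; lia.
Qed.

(** * The Bose-Mesner algebra, its idempotents and the dual idempotents *)

Section Scheme.
Context (C : numClosedFieldType) (X : finType) (D : nat) (Y : assoc_scheme X D).
Notation Amx := (assoc_mx C Y).

Lemma srel_class y z : exists i, srel Y i y z.
Proof. by have [i []] := srel_partition Y y z; exists i. Qed.

Lemma srel_inj i j y z : srel Y i y z -> srel Y j y z -> i = j.
Proof. by have [k [_ uk]] := srel_partition Y y z => /uk <- /uk. Qed.

(** The number of [i]-neighbours of a point is p^0_{ii}, the same for all points. *)
Lemma srel_out x i : exists y, srel Y i x y.
Proof.
have [y [z yz]] := srel_nonempty Y i.
have diag w : srel Y ord0 w w by rewrite srel0.
have := pnumP i i (diag x); rewrite -(pnumP i i (diag y)) => E.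
have : (0 < #|[set w | srel Y i x w && srel Y i w x]|)%N.
  by rewrite E; apply/card_gt0P; exists z; rewrite inE yz srel_sym.
by case/card_gt0P=> w; rewrite inE => /andP[xw _]; exists w.
Qed.

Lemma sum_assocE (c : 'I_D.+1 -> C) h y z :
  srel Y h (enum_val y) (enum_val z) -> (\sum_i c i *: Amx i) y z = c h.
Proof.
move=> yz; rewrite summxE (bigD1 h) //= !mxE yz mulr1 big1 ?addr0 // => i ih.
rewrite !mxE; case: (boolP (srel Y i _ _)) => [yz'|]; last by rewrite mulr0.
by rewrite (srel_inj yz yz') eqxx in ih.
Qed.

Lemma mul_assoc_mx i j : Amx i *m Amx j = \sum_h (pnum Y h i j)%:R *: Amx h.
Proof.
apply/matrixP => y z; have [h yz] := srel_class (enum_val y) (enum_val z).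
rewrite (sum_assocE _ yz) -(pnumP i j yz) mxE (reindex _ (onW_bij _ (@enum_rank_bij X))) /=.
rewrite -sum1dep_card natr_sum [RHS]big_mkcond /=; apply: eq_bigr => w _.
by rewrite !mxE enum_rankK -natrM mulnb; case: ifP.
Qed.

Lemma bose_mesnerP B :
  reflect (exists c : 'I_D.+1 -> C, B = \sum_i c i *: Amx i) (B \in bose_mesner C Y).
Proof.
apply: (iffP idP) => [MB|[c ->]].
  exists (fun i => coord [tuple Amx i | i < D.+1] i B); rewrite [LHS](coord_span MB).
  by apply: eq_bigr => i _; rewrite -tnth_nth tnth_mktuple.
by apply: memv_suml => i _; rewrite memvZ // memv_span // map_f ?mem_enum.
Qed.

Lemma bose_mesner_sym B : B \in bose_mesner C Y -> B^T = B.
Proof.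
case/bose_mesnerP=> c ->; apply/matrixP => y z; rewrite mxE.
have [h yz] := srel_class (enum_val y) (enum_val z).
by rewrite (sum_assocE _ yz) (@sum_assocE _ h) // srel_sym.
Qed.

Lemma bose_mesner_adjoint B : B \in bose_mesner C Y -> adjoint_mx B \in bose_mesner C Y.
Proof.
case/bose_mesnerP=> c ->; apply/bose_mesnerP; exists (fun i => (c i)^*).
apply/matrixP => y z; rewrite !mxE; have [h yz] := srel_class (enum_val y) (enum_val z).
by rewrite (sum_assocE _ yz) (@sum_assocE _ h) // srel_sym.
Qed.

Lemma bose_mesner_hadamard B B' : B \in bose_mesner C Y -> B' \in bose_mesner C Y ->
  map2_mx *%R B B' \in bose_mesner C Y.
Proof.
case/bose_mesnerP=> c -> /bose_mesnerP[c' ->]; apply/bose_mesnerP.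
exists (fun i => c i * c' i); apply/matrixP => y z; rewrite mxE.
have [h yz] := srel_class (enum_val y) (enum_val z).
by rewrite !(sum_assocE _ yz).
Qed.

Context (D_gt0 : (0 < D)%N) (hP : P_polynomial Y) (hab : almost_bipartite Y).
Context (E : 'I_D.+1 -> 'M[C]_#|X|) (hE : primitive_idempotents Y E).
Context (hQ : Q_polynomial E) (x : X).
Notation A := (Amx (inord 1)).
Notation As := (dual_adj E x).
Notation Es := (dual_idem C Y x).

Let i1 : (inord 1 : 'I_D.+1) = 1%N :> nat.
Proof. by rewrite inordK. Qed.

Let card_X : (#|X|%:R : C) != 0.
Proof. by rewrite pnatr_eq0 -lt0n; apply/card_gt0P; exists x. Qed.

Lemma idem_mem i : E i \in bose_mesner C Y.
Proof.
by have /andP[/eqP <- _] := pidem_basis hE; rewrite memv_span // map_f ?mem_enum.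
Qed.

Let Etup := [tuple E i | i < D.+1].

Let Etup_nth (i : 'I_D.+1) : Etup`_i = E i.
Proof. by rewrite -tnth_nth tnth_mktuple. Qed.

Lemma idem_coord B : B \in bose_mesner C Y -> B = \sum_i coord Etup i B *: E i.
Proof.
move=> MB; rewrite [LHS](coord_basis (pidem_basis hE) MB).
by apply: eq_bigr => i _; rewrite Etup_nth.
Qed.

Lemma idem_neq0 i : E i != 0.
Proof.
have /andP[_ /free_not0 nz] := pidem_basis hE.
by apply: nz; rewrite map_f ?mem_enum.
Qed.

Lemma bose_mesner_mulE B k : B \in bose_mesner C Y -> B *m E k = coord Etup k B *: E k.
Proof.
move=> MB; rewrite {1}(idem_coord MB) mulmx_suml (bigD1 k) //= big1 ?addr0 => [|j jk].
  by rewrite -scalemxAl (pidem_mul hE) eqxx.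
by rewrite -scalemxAl (pidem_mul hE) (negPf jk) scaler0.
Qed.

Lemma bose_mesner_comm B B' : B \in bose_mesner C Y -> B' \in bose_mesner C Y ->
  B *m B' = B' *m B.
Proof.
move=> MB MB'; rewrite (idem_coord MB') mulmx_sumr mulmx_suml; apply: eq_bigr => k _.
rewrite -scalemxAr -scalemxAl; congr (_ *: _); rewrite bose_mesner_mulE //.
rewrite -[RHS]trmxK trmx_mul (bose_mesner_sym MB) (bose_mesner_sym (idem_mem k)).
by rewrite bose_mesner_mulE // linearZ /= (bose_mesner_sym (idem_mem k)).
Qed.

Lemma assoc_mem i : Amx i \in bose_mesner C Y.
Proof. by rewrite memv_span // map_f ?mem_enum. Qed.

(** The adjoint stays in the commutative Bose-Mesner algebra, so [E i] is normal. *)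
Lemma idem_adjoint i : adjoint_mx (E i) = E i.
Proof.
apply: normal_idem_self_adjoint; first by rewrite (pidem_mul hE) eqxx.
by apply: bose_mesner_comm; rewrite ?bose_mesner_adjoint ?idem_mem.
Qed.

Definition eigval i : C := coord Etup i A.

Let triangular_pnumC : triangular (fun h i j => (pnum Y h i j)%:R : C).
Proof.
move=> h i j; have [p0 p1] := hP h i j; split=> [/p0->|/p1 nz] //.
by apply/eqP; rewrite pnatr_eq0; apply/eqP.
Qed.

(** If two eigenvalues agreed, every [Amx h], a polynomial in A, would act by one scalar on both
    eigenspaces, and hence so would [E i]. *)
Lemma eigval_inj : injective eigval.
Proof.
move=> i j ij; apply/eqP; apply: contraT => nij.
pose P (M : 'M[C]_#|X|) := exists c, M *m E i = c *: E i /\ M *m E j = c *: E j.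
have PL c u v : P u -> P v -> P (c *: u + v).
  move=> [cu [ui uj]] [cv [vi vj]]; exists (c * cu + cv).
  by rewrite !mulmxDl -!scalemxAl ui uj vi vj !scalerA !scalerDl.
have P0 : P 0 by exists 0; rewrite !mul0mx !scale0r.
have PA h : P (Amx h).
  apply: (triangular_ind (f := fun h i j => (pnum Y h i j)%:R) (mul := mulmx A)) => //.
  - by move=> k; apply: mul_assoc_mx.
  - exists 1; rewrite !scale1r (_ : Amx ord0 = 1%:M) ?mul1mx //.
    by apply/matrixP => y z; rewrite !mxE srel0 (inj_eq enum_val_inj).
  - move=> k [c [ci cj]]; exists (c * eigval i); rewrite -!mulmxA ci cj -!scalemxAr.
    rewrite !bose_mesner_mulE ?assoc_mem // !scalerA; split=> //.
    by rewrite -/(eigval j) -ij.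
have : P (E i).
  have /bose_mesnerP[c ->] := idem_mem i.
  by elim/big_ind: _ => // [u v Pu Pv|k _]; rewrite -1?[u]scale1r -1?[_ *: Amx k]addr0; apply: PL.
case=> c []; rewrite !(pidem_mul hE) eqxx (negPf nij) => Ei /esym/eqP.
rewrite scaler_eq0 (negPf (idem_neq0 j)) orbF => /eqP c0.
by move: (idem_neq0 i); rewrite Ei c0 scale0r eqxx.
Qed.

(** The value of |X| E_1 on the relation R_i, an eigenvalue of A^*. *)
Definition dual_eigval (i : 'I_D.+1) : C :=
  #|X|%:R * coord [tuple Amx h | h < D.+1] i (E (inord 1)).

Let E1_assoc : #|X|%:R *: E (inord 1) = \sum_i dual_eigval i *: Amx i.
Proof.
rewrite [X in _ *: X](coord_span (idem_mem _)) scaler_sumr; apply: eq_bigr => i _.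
by rewrite scalerA -tnth_nth tnth_mktuple.
Qed.

Let E1_entry h y z : srel Y h (enum_val y) (enum_val z) ->
  #|X|%:R * E (inord 1) y z = dual_eigval h.
Proof. by move=> yz; rewrite -(sum_assocE _ yz) -E1_assoc mxE. Qed.

Lemma dual_adjE : As = \sum_i dual_eigval i *: Es i.
Proof.
apply/matrixP => y z; rewrite summxE mxE.
have [h xy] := srel_class x (enum_val y).
have xy' : srel Y h (enum_val (enum_rank x)) (enum_val y) by rewrite enum_rankK.
rewrite (bigD1 h) //= !mxE xy big1 => [|i ih]; last first.
  rewrite !mxE; case: (boolP (srel Y i _ _)) => [xy''|]; last by rewrite mul0rn mulr0.
  by rewrite (srel_inj xy xy'') eqxx in ih.
by rewrite addr0 (E1_entry xy') mulrnAr mulr1.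
Qed.

(** If two values agreed, E_1 and, through entrywise products, every [E h] would agree at two pairs
    from R_i and R_j; [Amx i] separates them. *)
Lemma dual_eigval_inj : injective dual_eigval.
Proof.
move=> i j ij; apply/eqP; apply: contraT => nij.
have [yi xyi] := srel_out x i; have [yj xyj] := srel_out x j.
pose P (M : 'M[C]_#|X|) :=
  M (enum_rank x) (enum_rank yi) = M (enum_rank x) (enum_rank yj).
have PE h : P (E h).
  apply: (triangular_ind (f := krein E) (P := P)
    (mul := fun M => map2_mx *%R (#|X|%:R *: E (inord 1)) M)) => //.
  - by rewrite /P !mxE.
  - by move=> c u v; rewrite /P !mxE => -> ->.
  - move=> k; have -> : map2_mx *%R (#|X|%:R *: E (inord 1)) (E k) =
      #|X|%:R *: map2_mx *%R (E (inord 1)) (E k).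
      by apply/matrixP => y z; rewrite !mxE mulrA.
    rewrite [X in _ *: X]idem_coord ?bose_mesner_hadamard ?idem_mem //.
    by rewrite scaler_sumr; apply: eq_bigr => l _; rewrite scalerA.
  - by rewrite /P (pidem0 hE) !mxE.
  - move=> k; rewrite /P ![map2_mx _ _ _ _ _]mxE => ->; congr (_ * _).
    by rewrite !mxE (@E1_entry i) ?(@E1_entry j) ?enum_rankK.
have : P (Amx i).
  rewrite (idem_coord (assoc_mem i)) /P !summxE; apply: eq_bigr => k _.
  by rewrite !mxE; congr (_ * _); apply: PE.
rewrite /P !mxE !enum_rankK xyi; case: (boolP (srel Y i x yj)) => [xyj'|_].
  by rewrite (srel_inj xyj xyj') eqxx in nij.
by move/eqP; rewrite oner_eq0.
Qed.

Let pnum_neq0 h i j y z w : srel Y h y z -> srel Y i y w -> srel Y j w z ->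
  pnum Y h i j <> 0%N.
Proof.
move=> yz yw wz; rewrite -(pnumP i j yz) => /eqP; rewrite cards_eq0 => /eqP/setP/(_ w).
by rewrite !inE yw wz.
Qed.

Let dual_idem_entry (i j : 'I_D.+1) (M : 'M[C]_#|X|) y z :
  (Es i *m M *m Es j) y z =
  (srel Y i x (enum_val y))%:R * M y z * (srel Y j x (enum_val z))%:R.
Proof. by rewrite mul_mx_diag mul_diag_mx !mxE. Qed.

Lemma dual_tridiag : eigen_tridiag As Es dual_eigval A.
Proof.
split.
- move=> i j; apply/matrixP => y z; rewrite mul_diag_mx !mxE.
  have [->|yz] := eqVneq y z; last by case: eqP => _; rewrite !mxE ?(negPf yz) mulr0n mulr0.
  case: (boolP (srel Y i _ _)) => [xz|nxz]; last first.
    by rewrite mul0r; case: eqP => _; rewrite !mxE ?(negPf nxz) ?mul0rn.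
  case: (boolP (srel Y j _ _)) => [xz'|nxz'].
    by rewrite (srel_inj xz xz') eqxx !mxE xz' eqxx mul1r.
  have -> : i == j = false by apply: contraNF nxz' => /eqP <-.
  by rewrite !mxE mul0rn mulr0.
- apply/matrixP => y z; rewrite summxE mxE.
  have [h xy] := srel_class x (enum_val y).
  rewrite (bigD1 h) //= !mxE xy big1 ?addr0 // => i ih.
  rewrite !mxE; case: (boolP (srel Y i _ _)) => [xy'|]; last by rewrite mul0rn.
  by rewrite (srel_inj xy xy') eqxx in ih.
- exact: dual_adjE.
- exact: dual_eigval_inj.
- move=> i j ij; apply/matrixP => y z; rewrite dual_idem_entry !mxE.
  case: (boolP (srel Y i _ _)) => xy; rewrite ?mul0r //.
  case: (boolP (srel Y _ _ _)) => yz; rewrite ?mulr0 ?mul0r //.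
  case: (boolP (srel Y j _ _)) => xz; rewrite ?mulr0 //.
  have zy : srel Y (inord 1) (enum_val z) (enum_val y) by rewrite srel_sym.
  case: (pnum_neq0 xy xz zy); have [p0 _] := hP i j (inord 1); apply: p0.
  by rewrite i1; lia.
Qed.

Lemma dual_idem_flat (i : 'I_D.+1) : (i < D)%N -> Es i *m A *m Es i = 0.
Proof.
move=> iD; apply/matrixP => y z; rewrite dual_idem_entry !mxE.
case: (boolP (srel Y i _ _)) => xy; rewrite ?mul0r //.
case: (boolP (srel Y _ _ _)) => yz; rewrite ?mulr0 ?mul0r //.
case: (boolP (srel Y i _ _)) => xz; rewrite ?mulr0 //.
rewrite srel_sym in xy; rewrite srel_sym in xz.
by case: (pnum_neq0 xy yz xz); have [p0 _] := hab; apply: p0.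
Qed.

(* With [N = E_i As E_j], the trace of [N] times its adjoint is a multiple of the
   Krein parameter [q^1_{ij}]. *)
Lemma eigval_tridiag : eigen_tridiag A E eigval As.
Proof.
split.
- exact: (pidem_mul hE).
- exact: (pidem_sum hE).
- exact/idem_coord/assoc_mem.
- exact: eigval_inj.
- move=> i j ij; apply: mxtrace_adjoint_eq0.
  have q0 : krein E (inord 1) i j = 0.
    by have [q0 _] := hQ (inord 1) i j; apply: q0; rewrite i1; lia.
  have adjE (w : X) y : (E (inord 1) (enum_rank w) y)^* = E (inord 1) y (enum_rank w).
    by rewrite -{1}(idem_adjoint (inord 1)) !mxE conjCK.
  pose H := map2_mx *%R (E i) (E j).
  have EHE : E (inord 1) *m H *m E (inord 1) = 0.
    have MH : H \in bose_mesner C Y by rewrite bose_mesner_hadamard ?idem_mem.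
    rewrite -mulmxA bose_mesner_mulE // -scalemxAr (pidem_mul hE) eqxx.
    by move/eqP: q0; rewrite mulf_eq0 (negPf card_X) => /eqP ->; rewrite scale0r.
  have -> : adjoint_mx (E i *m As *m E j) = E j *m adjoint_mx As *m E i.
    by rewrite !adjoint_mxM !idem_adjoint mulmxA.
  rewrite !mulmxA mxtrace_mulC !mulmxA (pidem_mul hE) eqxx.
  rewrite -(mulmxA _ (E j) (E j)) (pidem_mul hE) eqxx.
  (* A^* is diagonal, so the trace is a double sum of entries of E_1, E_i, E_j: an entry of a matrix
     product at x. *)
  transitivity (#|X|%:R ^+ 2 * (E (inord 1) *m H *m E (inord 1)) (enum_rank x) (enum_rank x)).
    set As' := adjoint_mx As.
    have As'E : As' = diag_mx (\row_y (#|X|%:R * E (inord 1) y (enum_rank x))).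
      apply/matrixP => y z; rewrite !mxE rmorphMn rmorphM /= adjE conjC_nat eq_sym.
      by case: eqP => [->|] //; rewrite !mulr0n.
    rewrite As'E mxE mulr_sumr; apply: eq_bigr => y _.
    rewrite mul_mx_diag ![in LHS]mxE [in RHS]mxE !mulr_suml mulr_sumr.
    apply: eq_bigr => z _.
    have symE : E i y z = E i z y by rewrite -[in LHS](bose_mesner_sym (idem_mem i)) mxE.
    by rewrite mul_mx_diag !mxE symE; ring.
  by rewrite EHE mxE mulr0.
Qed.

(** * No two eigenvalues of A, equal or not, sum to zero *)

Lemma idem_coef_top_neq0 k (c : 'I_D.+1 -> C) :
  E k = \sum_l c l *: Amx l -> c ord_max != 0.
Proof.
move=> cE; apply: contraT; rewrite negbK => /eqP ctop.
have [l0 cl0] : exists l, c l != 0.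
  apply/existsP; apply: contraT; rewrite negb_exists => /forallP c0.
  move: (idem_neq0 k); rewrite cE big1 ?eqxx // => l _.
  by move: (c0 l); rewrite negbK => /eqP ->; rewrite scale0r.
(* If the last nonzero coefficient had index m < D, the entry of [A *m E k] on R_{m+1} would be c_m
   p^{m+1}_{1m}, nonzero, while that of [E k] is 0. *)
case: (@arg_maxnP _ l0 (fun l => c l != 0) val cl0) => m cm m_max.
have mD : (m < D)%N.
  rewrite ltn_neqAle -ltnS ltn_ord andbT; apply: contraNneq cm => mD.
  by rewrite (_ : m = ord_max) ?ctop //; apply: ord_inj.
have hm : (inord m.+1 : 'I_D.+1) = m.+1 :> nat by rewrite inordK.
have [y xy] := srel_out x (inord m.+1).
have xy' : srel Y (inord m.+1) (enum_val (enum_rank x)) (enum_val (enum_rank y)).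
  by rewrite !enum_rankK.
have := congr1 (fun M : 'M_#|X| => M (enum_rank x) (enum_rank y)) (bose_mesner_mulE k (assoc_mem (inord 1))).
rewrite {1}cE mulmx_sumr.
have -> : \sum_l A *m (c l *: Amx l) =
    \sum_h (\sum_l c l * (pnum Y h (inord 1) l)%:R) *: Amx h.
  under eq_bigr do rewrite -scalemxAr mul_assoc_mx scaler_sumr.
  rewrite exchange_big; apply: eq_bigr => h _; rewrite scaler_suml.
  by apply: eq_bigr => l _; rewrite scalerA.
rewrite (sum_assocE _ xy') mxE cE (sum_assocE _ xy').
have -> : c (inord m.+1) = 0.
  by apply/eqP; apply: contraT => /m_max /=; rewrite hm ltnn.
rewrite mulr0 (bigD1 m) //= big1 => [|l lm].
  rewrite addr0 => /eqP; rewrite mulf_eq0 (negPf cm) /= pnatr_eq0 => /eqP p0.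
  have [_ /(_ _ p0)[]] := hP (inord m.+1) (inord 1) m.
  by rewrite hm i1 add1n eqxx.
have [->|cl] := eqVneq (c l) 0; first by rewrite mul0r.
have lm' := m_max l cl; have [p0 _] := hP (inord m.+1) (inord 1) l; rewrite p0 ?mulr0 //.
by rewrite hm i1; move: lm lm'; rewrite -val_eqE /=; lia.
Qed.

Lemma idem_top_neq0 k : (E k *m Amx ord_max) (enum_rank x) (enum_rank x) != 0.
Proof.
have /bose_mesnerP[c cE] := idem_mem k; have c_top := idem_coef_top_neq0 cE.
have xx : srel Y ord0 (enum_val (enum_rank x)) (enum_val (enum_rank x)) by rewrite srel0.
rewrite cE mulmx_suml; under eq_bigr do rewrite -scalemxAl mul_assoc_mx.
rewrite summxE (bigD1 ord_max) //= mxE (sum_assocE _ xx) big1 => [|l lD].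
  rewrite addr0 mulf_neq0 // pnatr_eq0; apply/eqP.
  by have [_ p0] := hP ord0 ord_max ord_max; apply: p0; rewrite /= eqxx !orbT.
rewrite mxE (sum_assocE _ xx); have [p0 _] := hP ord0 l ord_max; rewrite p0 ?mulr0 //.
by move: lD (ltn_ord l); rewrite -val_eqE /=; lia.
Qed.

Lemma dual_idem_assoc i (c : 'I_D.+1 -> C) :
  Es i *m (\sum_l c l *: Amx l) *m delta_mx (enum_rank x) 0 =
  c i *: (Amx i *m delta_mx (enum_rank x) 0) :> 'cV[C]_#|X|.
Proof.
rewrite -mulmxA -!colE; apply/matrixP => y z; rewrite mul_diag_mx [LHS]mxE [col _ _ _ _]mxE.
have [h yx] := srel_class (enum_val y) (enum_val (enum_rank x)).
rewrite (sum_assocE _ yx) !mxE; move: yx; rewrite enum_rankK => yx.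
rewrite srel_sym; case: (boolP (srel Y i _ _)) => [yx'|_].
  by rewrite (srel_inj yx yx') mul1r mulr1.
by rewrite mul0r mulr0.
Qed.

(** Applied to the basis vector at x, [opposite_eigen_top] makes a product of the top coefficient of
    [E j], p^D_{1D} and an entry of [E k *m Amx ord_max] vanish, yet each factor is nonzero. *)
Lemma eigval_opp j k : eigval j + eigval k != 0.
Proof.
apply/negP => /eqP jk; pose e : 'cV[C]_#|X| := delta_mx (enum_rank x) 0.
have two0 : (2%:R : C) != 0 by rewrite pnatr_eq0.
have kj : eigval k + eigval j = 0 by rewrite addrC.
have := opposite_eigen_top eigval_tridiag dual_tridiag dual_idem_flat e kj two0.
have /bose_mesnerP[c cE] := idem_mem j.
rewrite (mulmxA _ (E j)) cE dual_idem_assoc -!scalemxAr (mulmxA A) mul_assoc_mx.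
rewrite (mulmxA (Es _)) dual_idem_assoc -!scalemxAr scalerA => /eqP.
rewrite scaler_eq0 mulf_eq0 (negPf (idem_coef_top_neq0 cE)) pnatr_eq0 /=.
have [_ /eqP/negPf ->] := hab; rewrite /= mulmxA -colE => /eqP /matrixP /(_ (enum_rank x) 0).
by rewrite mxE [RHS]mxE; apply/eqP/idem_top_neq0.
Qed.

Lemma top_dual_idem_inj k (w : 'cV[C]_#|X|) :
  E k *m w = w -> Es ord_max *m w = 0 -> w = 0.
Proof.
exact: (top_inj eigval_tridiag dual_tridiag dual_idem_flat eigval_opp).
Qed.

(** * Modules *)

Lemma terw_idem i : terwilliger Y x (E i).
Proof. exact/Terw_bm/idem_mem. Qed.

Lemma terw_dual_idem i : terwilliger Y x (Es i).
Proof. by apply/Terw_dbm; rewrite memv_span // map_f ?mem_enum. Qed.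

Lemma terw0 : terwilliger Y x (0 : 'M[C]_#|X|).
Proof. exact/Terw_bm/mem0v. Qed.

Lemma terw_sum (I : finType) (M : I -> 'M[C]_#|X|) :
  (forall i, terwilliger Y x (M i)) -> terwilliger Y x (\sum_i M i).
Proof. by move=> TM; elim/big_ind: _ => [|? ?|]; [exact: terw0 | exact: Terw_add|]. Qed.

Lemma terw_adj : terwilliger Y x A.
Proof. exact/Terw_bm/assoc_mem. Qed.

Lemma terw_dual_adj : terwilliger Y x As.
Proof. by rewrite dual_adjE; apply: terw_sum => i; apply/Terw_scale/terw_dual_idem. Qed.

Lemma terw_ext0 (F : 'I_D.+1 -> 'M[C]_#|X|) k :
  (forall i, terwilliger Y x (F i)) -> terwilliger Y x (ext0 F k).
Proof.
by move=> TF; case: k => k /=; [case: insubP => [i _ _|_] | ]; [exact: TF | |]; exact: terw0.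
Qed.

Lemma dual_bose_mesnerP B : B \in dual_bose_mesner C Y x ->
  exists c : 'I_D.+1 -> C, B = \sum_i c i *: Es i.
Proof.
move=> MB; exists (fun i => coord [tuple Es i | i < D.+1] i B); rewrite [LHS](coord_span MB).
by apply: eq_bigr => i _; rewrite -tnth_nth tnth_mktuple.
Qed.

Implicit Types U W : {vspace 'cV[C]_#|X|}.

Lemma T_module_mem U B w : T_module Y x U -> terwilliger Y x B -> w \in U -> B *m w \in U.
Proof. by move=> TU TB Uw; apply/(subvP (TU B TB))/mem_mximg. Qed.

(** The E_i are polynomials in A and the E^*_i polynomials in A^*, so these two matrices generate
    T. *)
Lemma T_moduleP U : T_module Y x U <-> stable A U /\ stable As U.
Proof.
split=> [TU|[sA sAs] B].
  by split=> w; apply: T_module_mem => //; [exact: terw_adj | exact: terw_dual_adj].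
have sE k := et_stable eigval_tridiag k sA.
have sEs k := et_stable dual_tridiag k sAs.
move=> TB; apply: mximg_sub; elim: TB => {B} [B MB|B MB|B1 B2 _ IH1 _ IH2|a B _ IH|B1 B2 _ IH1 _ IH2] w Uw.
- rewrite (idem_coord MB) mulmx_suml memv_suml // => i _.
  by rewrite -scalemxAl memvZ // sE.
- have [c ->] := dual_bose_mesnerP MB; rewrite mulmx_suml memv_suml // => i _.
  by rewrite -scalemxAl memvZ // sEs.
- by rewrite mulmxDl memvD ?IH1 ?IH2.
- by rewrite -scalemxAl memvZ ?IH.
- by rewrite -mulmxA IH1 ?IH2.
Qed.

Lemma irreducible_irred W : irreducible_T_module Y x W -> irred A As W.
Proof.
case=> TW W0 Wirr; have [sA sAs] := (T_moduleP W).1 TW; split=> // U sAU sAsU.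
by apply: Wirr; apply/T_moduleP.
Qed.

Lemma first_indexP (B A' : 'M[C]_#|X|) F th W :
  eigen_tridiag A' F th B -> W <> 0%VS -> exists r : 'I_D.+1,
    [/\ first_index F W = r,
        forall h : 'I_D.+1, (h < r)%N -> forall w, w \in W -> F h *m w = 0 &
        exists2 w, w \in W & F r *m w != 0].
Proof.
move=> hF W0; pose P i := mximg (F i) W != 0%VS.
have hasP : has P (enum 'I_D.+1).
  apply: contra_notT W0 => /hasPn noP; apply/eqP; rewrite -subv0; apply/subvP => w Ww.
  rewrite memv0; apply/eqP/(et_eq0 hF) => k; apply: (mximg_eq0 _ _ _) Ww.
  by have := noP k (mem_enum _ _); rewrite negbK.
have rD : (first_index F W < D.+1)%N.
  by rewrite -[X in (_ < X)%N](size_enum_ord D.+1) -has_find.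
exists (Ordinal rD); split=> //.
- move=> h hr; apply: (mximg_eq0 _ _ _).
  have := before_find ord0 hr; rewrite nth_ord_enum => /negbT.
  by rewrite negbK.
- apply: mximg_neq0; have := nth_find ord0 hasP.
  by rewrite (_ : nth _ _ _ = Ordinal rD) //; apply: ord_inj; rewrite nth_enum_ord.
Qed.

Lemma irreducible_irred_at W : irreducible_T_module Y x W ->
  exists r t : 'I_D.+1, [/\ endpoint Y x W = r, dual_endpoint E W = t &
    irred_at A As E Es r t W].
Proof.
move=> Wirr; have [_ W0 _] := Wirr.
have [r [rE Wr Wr0]] := first_indexP dual_tridiag W0.
have [t [tE Wt Wt0]] := first_indexP eigval_tridiag W0.
by exists r, t; split=> //; split=> //; apply: irreducible_irred.
Qed.

Let Einj := idem_inj eigval_tridiag dual_tridiag top_dual_idem_inj.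

Lemma irred_at_vect r t W : irred_at A As E Es r t W ->
  exists v, [/\ v \in W, E t *m v = v & v != 0].
Proof.
case=> [[sA _ _ _] _ _ _ [w Ww nz]]; exists (E t *m w).
by rewrite (et_stable eigval_tridiag) // (et_id eigval_tridiag).
Qed.

(** By [idem_inj], the levels that W meets are exactly those from [r] to D. *)
Lemma diameter_irred r t W : irred_at A As E Es r t W -> diameter Y x W = (D - r)%N.
Proof.
move=> Wat; have [v [Wv Ev v0]] := irred_at_vect Wat.
have -> : diameter Y x W = #|[set i : 'I_D.+1 | (r <= i)%N]|.-1.
  congr _.-1; apply: eq_card => i; rewrite !inE.
  have [ir|ri] := ltnP i r.
    by apply/negbF/mximg_eq0 => w Ww; have [_ /(_ i ir w Ww)] := Wat.
  apply/negP => /mximg_eq0/(_ v Wv)/(Einj Wat Wv Ev ri)/eqP.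
  by rewrite (negPf v0).
rewrite -sum1dep_card -(big_geq_mkord r D.+1 xpredT (fun=> 1%N)) sum_nat_const_nat muln1.
by have := ltn_ord r; lia.
Qed.

Lemma irred_at_isomorphic r t W W' :
  irreducible_T_module Y x W -> irreducible_T_module Y x W' ->
  irred_at A As E Es r t W -> irred_at A As E Es r t W' -> T_isomorphic Y x W W'.
Proof.
move=> [TW _ _] [TW' _ _] Wat Wat'.
pose iso := irred_iso eigval_tridiag dual_tridiag dual_idem_flat top_dual_idem_inj.
have [phi [phiW phi0 phiA phiAs]] := iso _ _ _ _ Wat Wat'.
(* The reverse injection gives equality of dimensions, so [phi] maps W onto W'. *)
have [psi [psiW' psi0 _ _]] := iso _ _ _ _ Wat' Wat.
have [sA sAs] := (T_moduleP W).1 TW.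
exists (linfun (mulmx phi)); split.
- move=> u w Wu Ww; rewrite !lfunE /= => /eqP; rewrite -subr_eq0 -mulmxBr => /eqP uw.
  by apply/eqP; rewrite -subr_eq0 (phi0 (u - w)) ?memvB.
- have ker0 : (W :&: lker (linfun (mulmx phi)) = 0)%VS.
    apply/eqP; rewrite -subv0; apply/subvP => w /memv_capP[Ww].
    by rewrite memv_ker lfunE /= => /eqP/phi0->; rewrite ?mem0v.
  apply/eqP; rewrite eqEdim mximg_sub //= limg_dim_eq //.
  exact: dim_mximg_inj psiW' psi0.
- move=> B TB; suff H w : w \in W -> phi *m (B *m w) = B *m (phi *m w).
    by move=> w Ww; rewrite !lfunE /= H.
  elim: TB w => {B} [B MB|B MB|B1 B2 _ IH1 _ IH2|a B _ IH|B1 B2 T1 IH1 T2 IH2] w Ww.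
  + rewrite (idem_coord MB) !mulmx_suml mulmx_sumr; apply: eq_bigr => i _.
    by rewrite -!scalemxAl -scalemxAr (et_comm eigval_tridiag _ sA).
  + have [c ->] := dual_bose_mesnerP MB.
    rewrite !mulmx_suml mulmx_sumr; apply: eq_bigr => i _.
    by rewrite -!scalemxAl -scalemxAr (et_comm dual_tridiag _ sAs).
  + by rewrite !mulmxDl mulmxDr IH1 ?IH2.
  + by rewrite -!scalemxAl -scalemxAr IH.
  + by rewrite -!mulmxA IH1 ?IH2 // T_module_mem.
Qed.

(** * Invariants of isomorphic modules *)

Section Isomorphic.
Context (W W' : {vspace 'cV[C]_#|X|}) (phi : 'End('cV[C]_#|X|)).
Context (TW : T_module Y x W) (phi_inj : {in W &, injective phi}).
Context (phiW : (phi @: W)%VS = W').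
Context (phiB : forall B, terwilliger Y x B -> {in W, forall w, phi (B *m w) = B *m phi w}).

Let phi_eq0 w : w \in W -> phi w = 0 -> w = 0.
Proof. by move=> Ww w0; apply: phi_inj; rewrite ?mem0v ?linear0. Qed.

Let W'P w' : w' \in W' -> exists2 w, w \in W & w' = phi w.
Proof. by rewrite -phiW => /memv_imgP. Qed.

Let W'_phi w : w \in W -> phi w \in W'.
Proof. by move=> Ww; rewrite -phiW memv_img. Qed.

Lemma mximg_iso B : terwilliger Y x B -> (mximg B W == 0%VS) = (mximg B W' == 0%VS).
Proof.
move=> TB; apply/mximg_eq0/mximg_eq0 => BW0.
  by move=> _ /W'P[w Ww ->]; rewrite -phiB // BW0 ?linear0.
move=> w Ww; apply: phi_eq0; first exact: T_module_mem.
by rewrite phiB // BW0 ?W'_phi.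
Qed.

Lemma endpoint_iso : endpoint Y x W = endpoint Y x W'.
Proof. by apply: eq_find => i; rewrite mximg_iso //; exact: terw_dual_idem. Qed.

Lemma dual_endpoint_iso : dual_endpoint E W = dual_endpoint E W'.
Proof. by apply: eq_find => i; rewrite mximg_iso //; exact: terw_idem. Qed.

Lemma diameter_iso : diameter Y x W = diameter Y x W'.
Proof.
by congr _.-1; apply: eq_card => i; rewrite !inE mximg_iso //; exact: terw_dual_idem.
Qed.

(** The two sets of admissible scalars coincide, and [xget] chooses from the set alone. *)
Lemma scalar_on_iso B P Q : terwilliger Y x B -> terwilliger Y x P -> terwilliger Y x Q ->
  scalar_on (mximg B W) P Q = scalar_on (mximg B W') P Q.
Proof.
move=> TB TP TQ; congr xget; apply/predeqP => a; split=> PQ v.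
  case/mximgP=> _ /W'P[w Ww ->]; rewrite -phiB // => -> nz.
  have BW : B *m w \in W by exact: T_module_mem.
  rewrite -!phiB // PQ ?linearZ ?mem_mximg //.
  by apply: contraNneq nz => ->; rewrite linear0.
case/mximgP=> w Ww -> nz; have BW : B *m w \in W by exact: T_module_mem.
apply: phi_inj; rewrite ?memvZ //; try exact: T_module_mem.
rewrite linearZ /= !(phiB, PQ) //.
  by rewrite mem_mximg ?W'_phi.
by apply: contraNneq nz; rewrite -phiB // => /phi_eq0->.
Qed.

Lemma tridiag_mx_iso (F : 'I_D.+1 -> 'M[C]_#|X|) M s B d :
  (forall i, terwilliger Y x (F i)) -> terwilliger Y x M -> terwilliger Y x B ->
  tridiag_mx F M s (mximg B W) d = tridiag_mx F M s (mximg B W') d.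
Proof.
move=> TF TM TB; have TF0 k := terw_ext0 k TF.
have Tr : terwilliger Y x (raising F M).
  by apply: terw_sum => i; apply: Terw_mul (TF i); apply: Terw_mul.
have Tf : terwilliger Y x (flat F M).
  by apply: terw_sum => i; apply: Terw_mul (TF i); apply: Terw_mul.
have Tl : terwilliger Y x (lowering F M).
  by apply: terw_sum => i; apply: Terw_mul (TF i); apply: Terw_mul.
by apply/matrixP => i j; rewrite !mxE /a_num /b_num /c_num !scalar_on_iso //; apply: Terw_mul.
Qed.

Lemma inter_mx_iso : inter_mx Y E x W = inter_mx Y E x W'.
Proof.
rewrite /inter_mx endpoint_iso dual_endpoint_iso diameter_iso; congr Tagged.
by apply: tridiag_mx_iso; [exact: terw_dual_idem|exact: terw_adj|apply: terw_ext0 terw_idem].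
Qed.

Lemma dual_inter_mx_iso : dual_inter_mx Y E x W = dual_inter_mx Y E x W'.
Proof.
rewrite /dual_inter_mx endpoint_iso dual_endpoint_iso diameter_iso; congr Tagged.
by apply: tridiag_mx_iso; [exact: terw_idem|exact: terw_dual_adj|apply: terw_ext0 terw_dual_idem].
Qed.

End Isomorphic.

(** * The eigenvalue at the dual endpoint, read off from B(W) *)

Lemma ext0_ord (V : nmodType) (F : 'I_D.+1 -> V) (i : 'I_D.+1) : ext0 F i%:Z = F i.
Proof. by rewrite /ext0 valK. Qed.

Lemma scalar_on_unique (U : {vspace 'cV[C]_#|X|}) P Q (a : C) v :
  v \in U -> v != 0 -> Q *m v != 0 ->
  (forall w, w \in U -> w != 0 -> P *m w = a *: (Q *m w)) -> scalar_on U P Q = a.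
Proof.
move=> Uv v0 Qv0 Pa; rewrite /scalar_on; set S := [set _ | _]%classic.
have /(_ v Uv v0) : S (xget 0 S) by apply: xgetPex; exists a.
rewrite (Pa v Uv v0) => /eqP; rewrite -subr_eq0 -scalerBl scaler_eq0 (negPf Qv0) orbF.
by rewrite subr_eq0 => /eqP.
Qed.

(* The row sums are all [eigval t]; row 0 is the one whose entries need only
   [A v = eigval t *: v] and [E^*_h v = 0] for [h < r]. *)
Lemma inter_mx_row0 r t W : irred_at A As E Es r t W ->
  endpoint Y x W = r -> dual_endpoint E W = t ->
  \sum_j tagged (inter_mx Y E x W) ord0 j = eigval t.
Proof.
move=> Wat rE tE; rewrite /inter_mx rE tE ext0_ord (diameter_irred Wat) /=.
have [v [Wv Ev v0]] := irred_at_vect Wat.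
have [[sA _ _ _] Wr _ _ _] := Wat.
have UP w : w \in mximg (E t) W -> w \in W /\ E t *m w = w.
  case/mximgP=> u Wu ->; rewrite (et_id eigval_tridiag).
  by split=> //; apply: (et_stable eigval_tridiag).
have Uv : v \in mximg (E t) W by rewrite -Ev mem_mximg.
have Esv0 : Es r *m v != 0.
  by apply: contraNneq v0 => /(Einj Wat Wv Ev (leqnn r))/eqP.
have Aw (w : 'cV[C]_#|X|) : E t *m w = w -> A *m w = eigval t *: w.
  by move=> <-; rewrite mulmxA (et_Aidem eigval_tridiag) scalemxAl.
have flatE (w : 'cV[C]_#|X|) : flat Es A *m (Es r *m w) = Es r *m (A *m (Es r *m w)).
  rewrite mulmx_suml (bigD1 r) //= big1 ?addr0 => [|k kr].
    by rewrite -!mulmxA (et_id dual_tridiag).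
  by rewrite -!mulmxA (et_neq dual_tridiag) ?mulmx0.
(* For r = D the diameter is 0 and W lies in E^*_D V, so the single entry a_0 is [eigval t]. *)
have [rD|Dr] := ltnP r D; last first.
  have rmax : r = ord_max by apply: ord_inj => /=; have := ltn_ord r; lia.
  have -> : (D - r)%N = 0%N by lia.
  rewrite big_ord1 mxE eqxx; apply: scalar_on_unique Uv v0 _ _.
    by rewrite addr0 ext0_ord.
  move=> w /UP[Ww Ew] _; rewrite addr0 ext0_ord -mulmxA flatE.
  have Erw : Es r *m w = w.
    rewrite [RHS](et_dec dual_tridiag) (bigD1 r) //= big1 ?addr0 // => k kr.
    by apply: Wr => //; move: kr; rewrite rmax -val_eqE /=; have := ltn_ord k; lia.
  by rewrite Erw Aw // -scalemxAr Erw.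
(* Otherwise row 0 is a_0, b_0 and zeros: a_0 = 0 since r < D, and level r receives from level r + 1
   only, so b_0 is [eigval t]. *)
case Dr: (D - r)%N => [|m]; first by lia.
rewrite big_ord_recl big_ord_recl /= big1 => [|j _]; last by rewrite !mxE.
rewrite addr0 !mxE /= -[RHS]add0r; congr (_ + _).
  apply: scalar_on_unique Uv v0 _ _; rewrite ?addr0 ?ext0_ord // => w _ _.
  by rewrite -mulmxA flatE 2!mulmxA dual_idem_flat // mul0mx scale0r.
have r1 : (inord r.+1 : 'I_D.+1) = r.+1 :> nat by rewrite inordK.
have -> : b_num Es A r (mximg (E t) W) 0 =
    scalar_on (mximg (E t) W) (lowering Es A *m Es (inord r.+1)) (Es r).
  by rewrite /b_num addr0 -PoszD addn1 -[in LHS]r1 !ext0_ord.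
apply: scalar_on_unique Uv v0 Esv0 _ => w /UP[Ww Ew] _.
have -> : lowering Es A *m Es (inord r.+1) = Es r *m A *m Es (inord r.+1).
  rewrite mulmx_suml (bigD1 (inord r.+1)) //= big1 ?addr0 => [|k kr].
    by rewrite r1 -addn1 PoszD addrK ext0_ord -mulmxA (et_idem dual_tridiag) eqxx.
  by rewrite -!mulmxA (et_idem dual_tridiag) (negPf kr) !mulmx0.
rewrite -!mulmxA scalemxAr -Aw // (et_FB dual_tridiag r w) (bigD1 (inord r.+1)) //=.
rewrite big1 ?addr0 // => k kr1.
have [kr|rk] := ltnP k r; first by rewrite (Wr k) ?mulmx0.
have [->|kr] := eqVneq k r; first by rewrite 2!mulmxA dual_idem_flat ?mul0mx.
by apply: (et_tri0 dual_tridiag); move: kr kr1; rewrite -!val_eqE /= r1; lia.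
Qed.

End Scheme.

(** * The cycle of implications between the five conditions *)

Theorem theorem14p1 (C : numClosedFieldType) (X : finType) (D : nat)
    (Y : assoc_scheme X D) (E : 'I_D.+1 -> 'M[C]_#|X|) (x : X)
    (W W' : {vspace 'cV[C]_#|X|}) :
  (3 <= D)%N ->
  P_polynomial Y ->
  almost_bipartite Y ->
  primitive_idempotents Y E ->
  Q_polynomial E ->
  irreducible_T_module Y x W ->
  irreducible_T_module Y x W' ->
  [<-> T_isomorphic Y x W W';
       dual_endpoint E W = dual_endpoint E W' /\
         diameter Y x W = diameter Y x W';
       dual_endpoint E W = dual_endpoint E W' /\
         endpoint Y x W = endpoint Y x W';
       inter_mx Y E x W = inter_mx Y E x W';
       dual_endpoint E W = dual_endpoint E W' /\
         dual_inter_mx Y E x W = dual_inter_mx Y E x W'].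
Proof.
move=> D3 hP hab hE hQ irrW irrW'.
have D0 : (0 < D)%N by exact: leq_trans D3.
have [r [t [rE tE Wat]]] := irreducible_irred_at D0 hP hE hQ irrW.
have [r' [t' [rE' tE' Wat']]] := irreducible_irred_at D0 hP hE hQ irrW'.
have dE := diameter_irred D0 hP hab hE hQ Wat.
have dE' := diameter_irred D0 hP hab hE hQ Wat'.
(* As r + d = D, the diameter determines the endpoint. *)
have diam_endpoint : diameter Y x W = diameter Y x W' -> r = r'.
  by rewrite dE dE' => E'; apply: ord_inj; have := ltn_ord r; have := ltn_ord r'; lia.
have iso : t = t' -> r = r' -> T_isomorphic Y x W W'.
  move=> tt rr; rewrite -{}tt -{}rr in Wat'.
  exact: (irred_at_isomorphic D0 hP hab hE hQ irrW irrW' Wat Wat').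
have [TW _ _] := irrW.
have iso_inter : T_isomorphic Y x W W' -> inter_mx Y E x W = inter_mx Y E x W'.
  by case=> phi [phi_inj phiW phiB]; apply: (inter_mx_iso hE TW phi_inj phiW phiB).
have iso_dual : T_isomorphic Y x W W' -> dual_inter_mx Y E x W = dual_inter_mx Y E x W'.
  by case=> phi [phi_inj phiW phiB]; apply: (dual_inter_mx_iso hE TW phi_inj phiW phiB).
(* The size of B(W) gives d and hence r; the sum of row 0 gives [eigval t] and hence t. *)
have ends : inter_mx Y E x W = inter_mx Y E x W' -> t = t' /\ r = r'.
  move=> BB; split; last by apply: diam_endpoint; apply: (congr1 (@tag _ _) BB).
  apply: (eigval_inj D0 hP hE).
  rewrite -(inter_mx_row0 D0 hP hab hE hQ Wat rE tE).
  by rewrite -(inter_mx_row0 D0 hP hab hE hQ Wat' rE' tE') BB.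
tfae.
- case=> phi [phi_inj phiW phiB]; split.
    exact: (dual_endpoint_iso hE TW phi_inj phiW phiB).
  exact: (diameter_iso TW phi_inj phiW phiB).
- by case=> tt /diam_endpoint rr; rewrite tt rE rE' rr.
- rewrite tE tE' rE rE' => -[tt rr]; apply: iso_inter.
  by apply: iso; apply: ord_inj.
- move/ends=> [tt rr]; split; first by rewrite tE tE' tt.
  exact/iso_dual/iso.
- rewrite tE tE' => -[tt BB]; apply: iso; first exact: ord_inj.
  by apply: diam_endpoint; apply: (congr1 (@tag _ _) BB).
Qed.
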